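(* Let $p$ be a prime, let $G$ be an elementary abelian $p$-group and let $k$ be a field of characteristic $p$. Suppose that $\mathcal{H}$ is a collection of subgroups of $G$ with the property that there is no pair $E, F$ of elements of $\mathcal{H}$ such that $E \subseteq F$ with index $p$. If $$0 \to C^0 \to C^1 \to \cdots \to C^\ell \to 0$$ is a bounded exact sequence of $kG$-modules, each term of which lies in $\mathsf{Add}(\{kG/E \mid E \in \mathcal{H}\})$, then the complex $C^*$ is contractible.
   Context: An elementary abelian $p$-group of rank $r$ is a group isomorphic to $C_p^r$, a direct product of $r$ copies of the cyclic group $C_p$ of order $p$. For a subgroup $E$ of $G$, $kG/E$ denotes the permutation $kG$-module on the set of cosets of $E$ in $G$. For a collection $\mathcal{S}$ of finitely generated $kG$-modules, $\mathsf{Add}(\mathcal{S})$ is the full additive subcategory of the category of $kG$-modules consisting of all $kG$-modules that are isomorphic to finite direct sums of copies of objects in $\mathcal{S}$. Contractible means that the identity map of the complex of $kG$-modules is chain homotopic to zero via $kG$-homomorphisms. *)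

(* Defs.v *)
From mathcomp Require Import all_boot all_order all_algebra.
From mathcomp Require Import all_fingroup all_solvable all_field all_character.

Set Implicit Arguments.
Unset Strict Implicit.
Unset Printing Implicit Defensive.

Import GroupScope GRing.Theory.
Local Open Scope ring_scope.

(* Finitely generated kG-modules are matrix representations of G over k, in   *)
(* MathComp's convention: vectors are rows and G acts on the right, so        *)
(* "A *m B" is "first A, then B", and rank-0 representations are allowed.     *)

Section PermutationModule.

Variables (k : fieldType) (gT : finGroupType) (G E : {group gT}).

(* The basis of k[G/E] is the set of right cosets E :* x with x in G, and g   *)
(* sends the basis vector E :* x to E :* (x * g).                             *)
Definition coset_mx (g : gT) : 'M[k]_#|rcosets E G| :=
  \matrix_(i, j) (enum_val i :* g == enum_val j)%:R.

Fact coset_mx_repr : mx_repr G coset_mx.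
Proof.
split=> [|x y Gx Gy]; apply/matrixP=> i j; rewrite !mxE.
  by rewrite rcoset1 (inj_eq enum_val_inj).
have Gi: enum_val i :* x \in rcosets E G.
  have /rcosetsP[z Gz ->] := enum_valP i.
  by rewrite -rcosetM; apply/rcosetsP; exists (z * x)%g; rewrite ?groupM.
have [l0 Dl0]: exists l0 : 'I_#|rcosets E G|, enum_val i :* x = enum_val l0.
  by exists (enum_rank_in Gi (enum_val i :* x)); rewrite enum_rankK_in.
rewrite (bigD1 l0) //= !mxE Dl0 eqxx mul1r -Dl0 -rcosetM big1 ?addr0 // => l.
by rewrite !mxE Dl0 (inj_eq enum_val_inj) eq_sym => /negPf->; rewrite mul0r.
Qed.

Definition coset_repr : representation k G :=
  Representation (MxRepresentation coset_mx_repr).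

End PermutationModule.

Section Modules.

Variables (k : fieldType) (gT : finGroupType) (G : {group gT}).
Local Notation kGmod := (representation k G).

Definition kG_hom (V W : kGmod) (f : 'M[k]_(rdegree V, rdegree W)) : Prop :=
  forall g, g \in G -> V g *m f = f *m W g.

Definition in_Add (S : kGmod -> Prop) (M : kGmod) : Prop :=
  exists (n : nat) (V : 'I_n -> kGmod),
    (forall i, S (V i)) /\ mx_rsim M (\big[dadd_grepr/grepr0]_(i < n) V i).

(* A complex 0 -> C^0 -> C^1 -> ... in nonnegative degrees.                   *)
Record cochain_complex := CochainComplex {
  cterm :> nat -> kGmod;
  cdiff : forall i, 'M[k]_(rdegree (cterm i), rdegree (cterm i.+1));
  cdiff_hom : forall i, kG_hom (cdiff i);
  cdiff_comp : forall i, cdiff i *m cdiff i.+1 = 0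
}.

(* C is 0 -> C^0 -> ... -> C^l -> 0, extended by zero modules.                *)
Definition bounded_by (l : nat) (C : cochain_complex) : Prop :=
  forall i, (l < i)%N -> rdegree (C i) = 0%N.

(* The kernel of each differential is the image of the previous one; the map  *)
(* into C^0 is 0.                                                             *)
Definition exact (C : cochain_complex) : Prop :=
  (kermx (cdiff C 0) == (0 : 'M_(rdegree (C 0%N))))%MS /\
  forall i, (kermx (cdiff C i.+1) == cdiff C i)%MS.

(* Families f, g of maps C^i -> D^i (meant to be chain maps) are homotopic    *)
(* through kG-homomorphisms h^i : C^(i+1) -> D^i.                             *)
Definition chain_homotopic (C D : cochain_complex)
    (f g : forall i, 'M[k]_(rdegree (C i), rdegree (D i))) : Prop :=
  exists h : forall i, 'M[k]_(rdegree (C i.+1), rdegree (D i)),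
    [/\ forall i, kG_hom (h i),
        f 0%N - g 0%N = cdiff C 0 *m h 0%N
      & forall i, f i.+1 - g i.+1
                  = cdiff C i.+1 *m h i.+1 + h i *m cdiff D i].

Definition contractible (C : cochain_complex) : Prop :=
  @chain_homotopic C C (fun i => 1%:M) (fun i => 0).

End Modules.

(* Main.v *)
(* Write lg for log_p of the order of a group, and n = lg G. Let J be the
   augmentation ideal of kG, and give the elements of J^t (F x) weight
   t + (p-1) lg(F)/2 in k[G/F]. A homomorphism k[G/F] -> k[G/F'] has its image in the
   F-fixed vectors, so it maps J^t into J^(t + (p-1) lg(F / F :&: F')). For distinct F
   and F' in H the index hypothesis says that lg(F / F :&: F') + lg(F' / F :&: F') >= 2,
   which means that the weight goes up by at least p-1.

   Fix E in H, extend k to k(t), and let X be a generic linear combination of the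
   x - 1, x in E; then X^p = 0. If F contains E, then X kills k[G/F]. Otherwise
   G = <x> \x W with x in E and F <= W; the J_W-adic filtration of k[G/F] is, in each
   degree, free over k[X]/(X^p), and it differs from the J-adic one by at most p-1.
   So the vectors of J_W-adic weight at least (p-1)(n - lg(E)/2), taken to be 0 when
   F contains E, form a functor which is free over k[X]/(X^p).

   If z is in the socle of the k[G/E]-part of C^0 and dz has no k[G/E]-component, then
   dz lies in the corresponding subcomplex. Dividing by X^(p-1), applying d, dividing by
   X, applying d, and so on, never leaves it, so unwinding by exactness puts z in
   C^0 X^(p-1); hence z = 0.

   Thus on socles C^0 -> C^1 is block triangular with injective diagonal blocks, and
   therefore it splits; the rest is an induction on the length. *)

Require Import Defs.
From mathcomp Require Import all_boot all_order all_algebra.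
From mathcomp Require Import all_fingroup all_solvable all_field all_character.
From mathcomp Require Import zify.

Set Implicit Arguments.
Unset Strict Implicit.
Unset Printing Implicit Defensive.

Import GroupScope GRing.Theory.
Local Open Scope ring_scope.

(** * Powers of the augmentation ideal *)

Section MatrixFrobenius.

Variables (k : fieldType) (p : nat).
Hypothesis char_k : p \in [pchar k].

Lemma pchar_mx n : p \in [pchar 'M[k]_n.+1].
Proof. by rewrite pchar_lalg. Qed.

Lemma mx_pFrobeniusD n (A B : 'M[k]_n) :
  comm_mx A B -> (A + B) ^+ p = A ^+ p + B ^+ p.
Proof.
case: n A B => [A B _|n A B cAB]; first by rewrite [LHS]thinmx0 [RHS]thinmx0.
exact: (pFrobenius_autD_comm (pchar_mx n) cAB).
Qed.

Lemma mx_pFrobenius_sum n (I : finType) (P : pred I) (A : I -> 'M[k]_n) :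
    (forall i j, P i -> P j -> comm_mx (A i) (A j)) ->
  (\sum_(i | P i) A i) ^+ p = \sum_(i | P i) A i ^+ p.
Proof.
move=> cA; rewrite -!(big_filter _ P).
have: all P (filter P (index_enum I)) by rewrite all_filter; apply/allP=> i _; apply/implyP.
elim: (filter P _) => [_|i s IHs /= /andP[Pi Ps]].
  by rewrite !big_nil -(prednK (prime_gt0 (pcharf_prime char_k))) exprS mul0r.
rewrite !big_cons mx_pFrobeniusD ?IHs //.
rewrite big_seq; apply: comm_mx_sum => j sj; apply: cA => //; exact: (allP Ps).
Qed.

Lemma mx_exprB1_pchar n (A : 'M[k]_n) : (A - 1) ^+ p = A ^+ p - 1.
Proof.
have p_gt0 := prime_gt0 (pcharf_prime char_k).
rewrite mx_pFrobeniusD; last by apply/comm_mxN/comm_mx1.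
congr (_ + _); case: n A => [A|n A]; first by rewrite [LHS]thinmx0 [RHS]thinmx0.
have := pFrobenius_autN (pchar_mx n) 1; rewrite pFrobenius_aut1.
exact.
Qed.

(** In [{poly k}] the factor ['X - 1] can be cancelled from ('X - 1)^p = 'X^p - 1; the identity is
    then evaluated at [A]. *)
Lemma mx_exprB1_pred n (A : 'M[k]_n) : (A - 1) ^+ p.-1 = \sum_(i < p) A ^+ i.
Proof.
have p_gt0 := prime_gt0 (pcharf_prime char_k).
case: n A => [A|n A]; first by rewrite [LHS]thinmx0 [RHS]thinmx0.
have polyE: ('X - 1 : {poly k}) ^+ p.-1 = \sum_(i < p) 'X ^+ i.
  have nz: ('X - 1 : {poly k}) != 0 by rewrite -(polyC1) polyXsubC_eq0.
  apply: (mulfI nz); rewrite -exprS prednK // -subrX1.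
  have := pFrobenius_autB_comm (rmorph_pchar (@polyC k) char_k) (commr1 'X).
  by rewrite pFrobenius_aut1.
have := congr1 (horner_mx A) polyE.
rewrite rmorphXn rmorphB /= horner_mx_X rmorph1 rmorph_sum /= => ->.
by apply: eq_bigr => i _; rewrite rmorphXn /= horner_mx_X.
Qed.

End MatrixFrobenius.

Section AugmentationPowers.

Variables (k : fieldType) (gT : finGroupType) (G : {group gT}).

(* The row space of [aug_pow rG A t] is J^t V, where V is the module of rG and
   J the augmentation ideal of kA. *)
Definition aug_pow n (rG : mx_representation k G n) (A : {set gT}) t : 'M[k]_n :=
  iter t (fun U => (\sum_(g in A) U *m (rG g - 1%:M))%MS) 1%:M.

Section OneModule.

Variables (n : nat) (rG : mx_representation k G n).
Local Notation J := (aug_pow rG).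

Lemma aug_powS_sub m (U : 'M_(m, n)) (A : {set gT}) t g :
  g \in A -> (U <= J A t)%MS -> (U *m (rG g - 1%:M) <= J A t.+1)%MS.
Proof.
move=> Ag sU; rewrite /aug_pow /= -/(aug_pow rG A t).
by apply: sumsmx_sup Ag _; apply: submxMr.
Qed.

Lemma aug_pow_subS m q (M : 'M_(n, q)) (V : 'M_(m, q)) (A : {set gT}) t :
    (forall g, g \in A -> (J A t *m (rG g - 1%:M) *m M <= V)%MS) ->
  (J A t.+1 *m M <= V)%MS.
Proof.
move=> sV; rewrite /aug_pow /= -/(aug_pow rG A t).
by rewrite sumsmxMr_gen; apply/sumsmx_subP=> g Ag; rewrite genmxE; apply: sV.
Qed.

Lemma aug_powS_le (A : {set gT}) t : (J A t.+1 <= J A t)%MS.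
Proof.
elim: t => [|t IHt]; first exact: submx1.
rewrite -[J A t.+2]mulmx1; apply: aug_pow_subS => g Ag.
by rewrite mulmx1 aug_powS_sub.
Qed.

Lemma aug_pow_leq (A : {set gT}) s t : (s <= t)%N -> (J A t <= J A s)%MS.
Proof.
move/subnKC <-; elim: (t - s)%N => [|m IHm]; first by rewrite addn0.
by rewrite addnS (submx_trans (aug_powS_le _ _)).
Qed.

Lemma aug_pow_sub (A B : {set gT}) t : A \subset B -> (J A t <= J B t)%MS.
Proof.
move=> sAB; elim: t => // t IHt; rewrite -[J A t.+1]mulmx1.
by apply: aug_pow_subS => g Ag; rewrite mulmx1 aug_powS_sub ?(subsetP sAB).
Qed.

Lemma aug_pow_triv (A : {set gT}) t :
  (forall g, g \in A -> rG g = 1%:M) -> J A t.+1 = 0.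
Proof.
move=> trA; apply/eqP; rewrite -submx0 -[J A _]mulmx1.
by apply: aug_pow_subS => g Ag; rewrite trA // subrr mulmx0 mul0mx sub0mx.
Qed.

End OneModule.

(** Commutation is asked only for [A], so that maps which are linear over a subgroup W, such as
    [coset_proj F W], are covered too. *)
Lemma aug_pow_hom n1 n2 (r1 : mx_representation k G n1)
    (r2 : mx_representation k G n2) (A : {set gT}) (f : 'M_(n1, n2)) s t :
    (forall g, g \in A -> r1 g *m f = f *m r2 g) ->
  (f <= aug_pow r2 A s)%MS -> (aug_pow r1 A t *m f <= aug_pow r2 A (t + s))%MS.
Proof.
move=> homf sf; elim: t => [|t IHt]; first by rewrite mul1mx.
apply: aug_pow_subS => g Ag; rewrite addSn -mulmxA.
have ->: (r1 g - 1%:M) *m f = f *m (r2 g - 1%:M).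
  by rewrite mulmxBl mulmxBr homf // mul1mx mulmx1.
by rewrite mulmxA aug_powS_sub.
Qed.

Lemma aug_pow_stable n1 n2 (r1 : mx_representation k G n1)
    (r2 : mx_representation k G n2) (A : {set gT}) (f : 'M_(n1, n2)) t :
    (forall g, g \in A -> r1 g *m f = f *m r2 g) ->
  (aug_pow r1 A t *m f <= aug_pow r2 A t)%MS.
Proof. by move=> homf; rewrite -{2}[t]addn0 aug_pow_hom ?submx1. Qed.

End AugmentationPowers.

Section AugmentationAbelian.

Variables (k : fieldType) (p : nat) (gT : finGroupType) (G : {group gT}).
Hypotheses (char_k : p \in [pchar k]) (abelG : p.-abelem G).
Variables (n : nat) (rG : mx_representation k G n).
Local Notation J := (aug_pow rG).

Let p_pr : prime p := pcharf_prime char_k.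
Let p_gt0 : (0 < p)%N := prime_gt0 p_pr.
Let cGG : abelian G. Proof. exact: abelem_abelian abelG. Qed.

Lemma repr_mx_comm x y : x \in G -> y \in G -> rG x *m rG y = rG y *m rG x.
Proof.
by move=> Gx Gy; rewrite -!repr_mxM // (centsP cGG _ Gx _ Gy).
Qed.

Lemma repr_mxX_gen x i : x \in G -> rG (x ^+ i)%g = rG x ^+ i.
Proof.
move=> Gx; elim: i => [|i IHi]; first by rewrite expg0 expr0 repr_mx1.
by rewrite expgS exprS repr_mxM ?groupX // IHi.
Qed.

Lemma repr_mx_expr_p x : x \in G -> rG x ^+ p = 1.
Proof.
move=> Gx; rewrite -repr_mxX_gen //.
by case/(abelemP p_pr): abelG => _ ->; rewrite ?repr_mx1.
Qed.

Lemma repr_mxB1_expr_p x : x \in G -> (rG x - 1) ^+ p = 0.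
Proof. by move=> Gx; rewrite (mx_exprB1_pchar char_k) repr_mx_expr_p ?subrr. Qed.

Lemma aug_pow_mulr (A : {set gT}) t x :
  A \subset G -> x \in G -> (J A t *m rG x <= J A t)%MS.
Proof.
move=> sAG Gx; apply: aug_pow_stable => g Ag.
by rewrite repr_mx_comm // (subsetP sAG).
Qed.

Lemma repr_mx_commX x y i : x \in G -> y \in G ->
  rG x *m rG y ^+ i = rG y ^+ i *m rG x.
Proof. by move=> Gx Gy; rewrite -repr_mxX_gen // repr_mx_comm ?groupX. Qed.

Lemma repr_mx_comm_sumX x y i : x \in G -> y \in G ->
  rG x *m (\sum_(l < i) rG y ^+ l) = (\sum_(l < i) rG y ^+ l) *m rG x.
Proof.
by move=> Gx Gy; apply: comm_mx_sum => l _; apply: repr_mx_commX.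
Qed.

Lemma repr_mxB1_split e i w : e \in G -> w \in G ->
  rG (e ^+ i * w)%g - 1%:M
    = (rG w - 1%:M) *m rG (e ^+ i)%g
      + (rG e - 1) *m \sum_(l < i) rG e ^+ l.
Proof.
move=> Ge Gw; rewrite [(rG e - 1) *m _](esym (subrX1 _ _)) -repr_mxX_gen //.
by rewrite mulmxBl mul1mx repr_mxM ?groupX // repr_mx_comm ?groupX // subrKA.
Qed.

(** Modulo J_W the ideal J_A is generated by e - 1, and (e - 1)^p = 0; so of t + p - 1 factors from
    J_A, at most p - 1 are spent on e - 1. *)
Lemma aug_pow_step (A W : {group gT}) e t :
    A \subset G -> W \subset G -> e \in G -> A \subset (<[e]> * W)%g ->
  (J A (t + p.-1) <= J W t)%MS.
Proof.
move=> sAG sWG Ge sAeW; set eps := rG e - 1.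
(* The exponent of [eps] counts the factors e - 1 already collected: one more factor from J_A either
   gives a factor from J_W or adds an [eps], and [eps ^+ p] vanishes. *)
suffices main j: (j < p)%N -> (J A (t + j) *m eps ^+ (p.-1 - j) <= J W t)%MS.
  have:= main p.-1; rewrite subnn expr0 mulmx1; apply.
  by rewrite prednK.
have step m s i : (J A m *m eps ^+ i <= J W s)%MS ->
    (J A m *m eps ^+ i.+1 <= J W s.+1)%MS ->
  (J A m.+1 *m eps ^+ i <= J W s.+1)%MS.
  move=> le1 le2; apply: aug_pow_subS => g Ag.
  have /mulsgP[_ w /cycleP[l ->] Ww defg] := subsetP sAeW g Ag.
  have Gw := subsetP sWG w Ww.
  rewrite defg repr_mxB1_split // mulmxDr mulmxDl addmx_sub //.
    have -> : J A m *m ((rG w - 1%:M) *m rG (e ^+ l)%g) *m eps ^+ i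
      = J A m *m eps ^+ i *m (rG w - 1%:M) *m rG (e ^+ l)%g.
      rewrite -!mulmxA; congr (_ *m _); rewrite 2!mulmxA.
      rewrite -[LHS]mulmxA; set c := rG _.
      have cX x: x \in G -> rG x *m eps ^+ i = eps ^+ i *m rG x.
        move=> Gx; apply: commrX; apply: commrB; last exact: commr1.
        exact: repr_mx_comm.
      by rewrite cX ?groupX // !mulmxA mulmxBl mulmxBr cX // mul1mx mulmx1.
    apply: submx_trans (aug_pow_mulr _ sWG (groupX l Ge)).
    by apply: submxMr; apply: aug_powS_sub.
  have -> : J A m *m ((rG e - 1) *m (\sum_(j0 < l) rG e ^+ j0)) *m eps ^+ i
      = J A m *m eps ^+ i.+1 *m \sum_(j0 < l) rG e ^+ j0.
    rewrite exprS -mulmxE -!mulmxA; congr (_ *m (_ *m _)).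
    apply: commrX; apply: commrB; last exact: commr1.
    by apply: commr_sym; apply: repr_mx_comm_sumX.
  apply: submx_trans (submxMr _ le2) _; apply: aug_pow_stable => x Wx.
  by apply: repr_mx_comm_sumX; rewrite ?(subsetP sWG x Wx).
elim: t j => [|t IHt] j; first by rewrite submx1.
elim: j => [|j IHj] ltjp; rewrite addSn; apply: step; rewrite ?IHt //.
  by rewrite subn0 prednK // repr_mxB1_expr_p // mulmx0 sub0mx.
by rewrite addnS -addSn -subSn ?IHj ?(ltnW ltjp) // -ltnS prednK.
Qed.

Lemma abelem_maximal_cycle (A W : {group gT}) :
    A \subset G -> maximal W A ->
  exists2 e, e \in A & [/\ #|A : W|%g = p, W \subset A & A \subset (<[e]> * W)%g].
Proof.
move=> sAG maxW; have pA := pgroupS sAG (abelem_pgroup abelG).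
have /andP[sWA /subsetPn[e Ae notWe]] := maxgroupp maxW.
exists e => //; split=> //; first exact: p_maximal_index pA maxW.
have cAA := abelianS sAG cGG.
have seA : <[e]> \subset A by rewrite cycle_subG.
rewrite -(cent_joinEr (sub_abelian_cent2 cAA sWA seA)).
have /maximal_eqP[_ maxW'] : maximal_eq W A by apply/orP; right.
have [||defW | -> //] := maxW' (<[e]> <*> W)%G; rewrite ?joing_subr //.
  by rewrite join_subG seA.
by case/negP: notWe; rewrite -{1}defW mem_gen // inE cycle_id.
Qed.

(** Going down a chain of maximal subgroups from A to F, each of the lg(A/F) links costs p - 1 by
    [aug_pow_step]. *)
Lemma aug_pow_index (A F : {group gT}) t :
    A \subset G -> F \subset A ->
  (J A (t + p.-1 * logn p #|A : F|) <= J F t)%MS.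
Proof.
have [m] := ubnP #|A : F|; elim: m A t => // m IHm A t leAFm sAG sFA.
have [-> | [W maxW sFW]] := maximal_exists sFA.
  by rewrite indexgg logn1 muln0 addn0.
have [e Ae [indW sWA sAeW]] := abelem_maximal_cycle sAG maxW.
have sWG := subset_trans sWA sAG.
rewrite -(Lagrange_index sWA sFW) indW lognM ?indexg_gt0 // logn_prime // eqxx.
rewrite mulnDr muln1 [(p.-1 + _)%N]addnC addnA.
apply: submx_trans (aug_pow_step _ sAG sWG (subsetP sAG e Ae) sAeW) _.
apply: IHm => //; rewrite -(Lagrange_index sWA sFW) indW ltnS in leAFm.
by apply: leq_trans leAFm; rewrite ltn_Pmull ?prime_gt1 ?indexg_gt0.
Qed.

End AugmentationAbelian.

(** * Sums over groups, complements and norms *)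

Section GroupSums.

Variables (V : nmodType) (gT : finGroupType).

Lemma sum_mulg_TI (A B : {group gT}) (f : gT -> V) : (A :&: B = 1)%g ->
  \sum_(x in (A * B)%g) f x = \sum_(a in A) \sum_(b in B) f (a * b)%g.
Proof.
move=> tiAB; rewrite -imset_mulgm big_imset => [|[a b] [a' b']] /=.
  rewrite pair_big /=; apply: eq_big => [[a b]|[a b] _] //=.
  by rewrite in_setX.
rewrite !in_setX => /andP[Aa Bb] /andP[Aa' Bb'] /= eq_ab.
have eq1: (a'^-1 * a = b' * b^-1)%g.
  by apply: (mulgI a'); apply: (mulIg b); rewrite !mulgA mulgV mul1g mulgKV.
have: (a'^-1 * a)%g \in (A :&: B)%g by rewrite inE {2}eq1 !groupM ?groupV.
rewrite tiAB => /set1gP a1.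
have eqa: a = a' by apply: (mulgI a'^-1%g); rewrite a1 mulVg.
by move: eq_ab; rewrite eqa => /mulgI->.
Qed.

Lemma sum_cycle (a : gT) (f : gT -> V) :
  \sum_(x in <[a]>%g) f x = \sum_(i < #[a]%g) f (a ^+ i)%g.
Proof.
have -> : <[a]>%g = [set (a ^+ (i : 'I_#[a]%g))%g | i in [set: 'I_#[a]%g]].
  apply/setP=> x; apply/cycleP/imsetP=> [[i ->] | [i _ ->]]; last by exists i.
  exists (Ordinal (ltn_pmod i (order_gt0 a))); first by rewrite inE.
  by rewrite expg_mod_order.
rewrite big_imset /=; first by apply: eq_bigl => i; rewrite inE.
by move=> i j _ _ /eqP; rewrite eq_expg_mod_order !modn_small // => /eqP/val_inj.
Qed.

End GroupSums.

Section ElementaryAbelian.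

Variables (p : nat) (gT : finGroupType) (G : {group gT}).
Hypothesis abelG : p.-abelem G.

(** W is F times a complement of AF in G; counting orders shows that it meets A trivially. *)
Lemma abelem_TI_compl (A F : {group gT}) :
    A \subset G -> F \subset G -> (A :&: F = 1)%g ->
  exists W : {group gT},
    [/\ W \subset G, F \subset W, (A * W = G)%g & (A :&: W = 1)%g].
Proof.
move=> sAG sFG tiAF; have cGG := abelem_abelian abelG.
have sAFG: A <*> F \subset G by rewrite join_subG sAG.
have /splitsP[B /complP[tiB defG]] := abelem_splits abelG sAFG.
have sBG: B \subset G by rewrite -defG mulG_subr.
have cFB: B \subset 'C(F) by apply: sub_abelian_cent2 cGG _ _.
have cAF: F \subset 'C(A) by apply: sub_abelian_cent2 cGG _ _.
have defAW: (A * (F <*> B) = G)%g by rewrite cent_joinEr // mulgA -(cent_joinEr cAF).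
exists (F <*> B)%G; split; rewrite ?joing_subl ?join_subG ?sFG //.
apply/eqP; rewrite trivg_card_le1 -(@leq_pmul2l #|(A * (F <*> B))%g|); last first.
  by rewrite defAW cardG_gt0.
rewrite -mul_cardG muln1 defAW -defG (TI_cardMg tiB).
rewrite /= (cent_joinEr cFB) (cent_joinEr cAF) (TI_cardMg tiAF) -mulnA leq_mul2l.
by rewrite mul_cardG leq_pmulr ?orbT ?cardG_gt0.
Qed.

End ElementaryAbelian.

Section NormSums.

Variables (k : fieldType) (p : nat) (gT : finGroupType) (G : {group gT}).
Hypotheses (char_k : p \in [pchar k]) (abelG : p.-abelem G).
Variables (n : nat) (rG : mx_representation k G n).
Local Notation J := (aug_pow rG).

Let p_pr : prime p := pcharf_prime char_k.

Lemma aug_powX_sub m (U : 'M_(m, n)) (A : {set gT}) t g i :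
  g \in A -> (U <= J A t)%MS -> (U *m (rG g - 1) ^+ i <= J A (t + i))%MS.
Proof.
move=> Ag sU; elim: i => [|i IHi]; first by rewrite addn0 mulmx1.
by rewrite exprSr addnS -mulmxE mulmxA aug_powS_sub.
Qed.

Lemma sum_repr_mx_cycle a : a \in G -> a != 1%g ->
  \sum_(x in <[a]>%g) rG x = (rG a - 1) ^+ p.-1.
Proof.
move=> Ga nt_a; rewrite (mx_exprB1_pred char_k) sum_cycle.
rewrite (abelem_order_p abelG Ga nt_a).
by apply: eq_bigr => i _; rewrite repr_mxX_gen.
Qed.

(** A is a direct product of lg(A) cyclic groups <a> of order p, and its norm is the product of the
    elements (a - 1)^(p-1). *)
Lemma sum_repr_mx_sub_aug (A : {group gT}) : A \subset G ->
  ((\sum_(x in A) rG x)%R <= J A (p.-1 * logn p #|A|))%MS.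
Proof.
have [m] := ubnP #|A|; elim: m A => // m IHm A /ltnSE-leAm sAG.
have [-> | /trivgPn[a Aa nt_a]] := eqVneq (A : {set gT}) 1%g.
  by rewrite cards1 logn1 muln0 submx1.
have Ga := subsetP sAG a Aa.
have saA : <[a]> \subset A by rewrite cycle_subG.
have /splitsP[B /complP[tiB defA]] := abelem_splits (abelemS sAG abelG) saA.
have sBA: B \subset A by rewrite -defA mulG_subr.
have cBa: (<[a]> * B = B * <[a]>)%g.
  apply: normC; apply: cents_norm.
  by apply: sub_abelian_cent2 (abelem_abelian abelG) _ _; rewrite ?(subset_trans _ sAG).
have oA: #|A| = (p * #|B|)%N.
  by rewrite -defA (TI_cardMg tiB) -orderE (abelem_order_p abelG Ga nt_a).
have -> : \sum_(x in A) rG x = \sum_(x in (B * <[a]>)%g) rG x by rewrite -cBa defA.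
rewrite sum_mulg_TI; last by rewrite setIC.
rewrite (eq_bigr (fun b => rG b *m \sum_(x in <[a]>%g) rG x)); last first.
  move=> b Bb; rewrite mulmx_sumr; apply: eq_bigr => x ax.
  by rewrite repr_mxM //; apply: (subsetP sAG); [apply: (subsetP sBA) | apply: (subsetP saA)].
rewrite -mulmx_suml sum_repr_mx_cycle // oA lognM ?(prime_gt0 p_pr) ?cardG_gt0 //.
rewrite (logn_prime p p_pr) eqxx mulnDr muln1 addnC aug_powX_sub //.
apply: (submx_trans _ (aug_pow_sub rG _ sBA)); apply: IHm; last exact: subset_trans sAG.
by apply: leq_trans (leAm : _ <= _)%N; rewrite oA ltn_Pmull ?prime_gt1 ?cardG_gt0.
Qed.

End NormSums.

(** * The modules k[G/F] *)

Section CosetModule.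

Variables (k : fieldType) (p : nat) (gT : finGroupType) (G : {group gT}).
Hypotheses (char_k : p \in [pchar k]) (abelG : p.-abelem G).

Let p_pr : prime p := pcharf_prime char_k.
Let cGG : abelian G := abelem_abelian abelG.

Local Notation R F := (coset_repr k G F).

(** For a subgroup W between F and G, k[G/F] is induced from k[W/F], and this is the projection onto
    that W-summand. Arbitrary sets [S] are allowed because translates of W occur. *)
Definition coset_proj (F : {group gT}) (S : {set gT}) : 'M[k]_#|rcosets F G| :=
  diag_mx (\row_(i < #|rcosets F G|) (enum_val i \subset S)%:R).

Lemma coset_proj_shift (F : {group gT}) (S : {set gT}) a :
  R F a *m coset_proj F S = coset_proj F (S :* a^-1) *m R F a.
Proof.
apply/matrixP=> i j; rewrite mul_mx_diag mul_diag_mx !mxE.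
case: eqP => [<- | _]; last by rewrite mul0r mulr0.
by rewrite mul1r mulr1 sub_rcosetV.
Qed.

Lemma coset_proj_comm (F W : {group gT}) x : x \in W ->
  R F x *m coset_proj F W = coset_proj F W *m R F x.
Proof. by move=> Wx; rewrite coset_proj_shift rcoset_id ?groupV. Qed.

(** A is a transversal of W in G, so each coset of F lies in exactly one translate of W. The
    identity is thus a relative trace, as in Higman's criterion. *)
Lemma coset_proj_sum (F A W : {group gT}) :
    F \subset W -> W \subset G -> (A * W = G)%g -> (A :&: W = 1)%g ->
  \sum_(a in A) R F a^-1%g *m coset_proj F W *m R F a = 1%:M.
Proof.
move=> sFW sWG defG tiAW; have sAG: A \subset G by rewrite -defG mulG_subl.
have defWA: (W * A = G)%g by rewrite -normC // cents_norm // (sub_abelian_cent2 cGG).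
transitivity (\sum_(a in A) coset_proj F (W :* a)).
  apply: eq_bigr => a Aa; have Ga := subsetP sAG a Aa.
  by rewrite coset_proj_shift invgK repr_mxKV.
rewrite -diag_const_mx -(raddf_sum (@diag_mx k _)); congr diag_mx.
apply/rowP=> i; rewrite summxE mxE.
have /rcosetsP[x Gx defi] := enum_valP i.
have /mulsgP[w a Ww Aa defx]: x \in (W * A)%g by rewrite defWA.
rewrite (bigD1 a) //= mxE big1 => [|b /andP[Ab neq_ba]].
  rewrite addr0 defi defx rcosetM.
  suff -> : (F :* w) :* a \subset W :* a by [].
  by apply: mulSg; rewrite -(rcoset_id Ww) mulSg.
rewrite mxE defi; suff -> : (F :* x \subset W :* b) = false by [].
apply/negP=> sxb; case/negP: neq_ba.
have: x \in W :* b by rewrite (subsetP sxb) ?rcoset_refl.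
rewrite mem_rcoset defx -mulgA groupMl // => Wab.
have: (a * b^-1)%g \in A :&: W by rewrite inE Wab groupM ?groupV.
by rewrite tiAW => /set1gP/eqP; rewrite -eq_mulgV1 eq_sym.
Qed.

Lemma coset_repr_triv (F : {group gT}) x : F \subset G -> x \in F -> R F x = 1%:M.
Proof.
move=> sFG Fx; have Gx := subsetP sFG x Fx.
apply/matrixP=> i j; rewrite !mxE -(inj_eq enum_val_inj).
have /rcosetsP[y Gy ->] := enum_valP i.
by rewrite -rcosetM (centsP cGG _ Gy _ Gx) rcosetM rcoset_id.
Qed.

(** F acts trivially on k[G/F], and 1 + (p-1) lg(G/F) factors from J_G yield one factor from J_F. *)
Lemma aug_pow_coset_max (F : {group gT}) t : F \subset G ->
  (p.-1 * logn p #|G : F| < t)%N -> aug_pow (R F) G t = 0.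
Proof.
move=> sFG ltmt; apply/eqP; rewrite -submx0.
apply: submx_trans (aug_pow_leq _ _ ltmt) _; rewrite -add1n.
apply: submx_trans (aug_pow_index char_k abelG _ _ (subxx G) sFG) _.
by rewrite aug_pow_triv // => g Fg; apply: coset_repr_triv.
Qed.

(* Higman's criterion for a complement A' of A :&: F in A, which acts freely on
   the cosets of F: the A'-fixed vectors are images of the norm of A'. *)
Lemma fixed_sub_aug_pow (F A : {group gT}) m (M : 'M_(m, #|rcosets F G|)) :
    F \subset G -> A \subset G -> (forall x, x \in A -> M *m R F x = M) ->
  (M <= aug_pow (R F) G (p.-1 * logn p #|A : (A :&: F)%SET|))%MS.
Proof.
move=> sFG sAG fixM.
have /splitsP[B /complP[tiB defA]] := abelem_splits (abelemS sAG abelG) (subsetIl A F).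
have sBA: B \subset A by rewrite -defA mulG_subr.
have sBG := subset_trans sBA sAG.
have tiBF: (B :&: F = 1)%g.
  by apply/trivgP; rewrite -tiB subsetI subsetIl setSI.
have [W [sWG sFW defG tiBW]] := abelem_TI_compl abelG sBG sFG tiBF.
have -> : M = M *m coset_proj F W *m \sum_(a in B) R F a.
  rewrite -{1}[M]mulmx1 -(coset_proj_sum sFW sWG defG tiBW) !mulmx_sumr.
  apply: eq_bigr => b Bb; rewrite !mulmxA fixM // groupV; exact: (subsetP sBA).
have -> : #|A : A :&: F|%g = #|B|.
  by rewrite -divgS ?subsetIl // -{1}defA (TI_cardMg tiB) mulKn ?cardG_gt0.
apply: submx_trans (submxMl _ _) _.
apply: submx_trans (sum_repr_mx_sub_aug char_k abelG _ sBG) _.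
exact: aug_pow_sub.
Qed.

Lemma coset_hom_sub_aug_pow (F1 F2 : {group gT}) (f : 'M[k]_(_, _)) :
    F1 \subset G -> F2 \subset G -> kG_hom (V := R F1) (W := R F2) f ->
  (f <= aug_pow (R F2) G (p.-1 * logn p #|F1 : (F1 :&: F2)%SET|))%MS.
Proof.
move=> sF1G sF2G homf; apply: fixed_sub_aug_pow => // x F1x.
by rewrite -homf ?(subsetP sF1G) // coset_repr_triv // mul1mx.
Qed.

End CosetModule.

(** * The generic element X and the associated filtration *)

(** Successive approximation along a decreasing filtration that reaches 0. The last hypothesis on
    [D] puts the kernel of X in the image of Y on the associated graded, and [Y *m X = 0] keeps
    every remainder in the kernel of X. *)
Lemma filtered_exact (k : fieldType) m n (D : nat -> 'M[k]_n) (X Y : 'M_n) T t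
    (U : 'M_(m, n)) :
    D T = 0 -> (forall i, D i.+1 <= D i)%MS -> Y *m X = 0 ->
    (forall i (V : 'M_(m, n)), (V <= D i)%MS -> (V *m X <= D i.+1)%MS ->
       exists2 V' : 'M_(m, n), (V' <= D i)%MS & (V - V' *m Y <= D i.+1)%MS) ->
  (U <= D t)%MS -> U *m X = 0 -> (U <= D t *m Y)%MS.
Proof.
move=> DT0 leD YX0 exD sUD UX0.
have le0 i: D (T + i)%N = 0.
  elim: i => [|i IHi]; first by rewrite addn0.
  by apply/eqP; rewrite -submx0 addnS -IHi leD.
have [m' le_m'] := ubnP (T - t)%N.
elim: m' t U le_m' sUD UX0 => // m' IHm t U ltTm sUD UX0.
have [leTt | ltTt] := leqP T t.
  by move: sUD; rewrite -(subnKC leTt) le0 submx0 => /eqP->; apply: sub0mx.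
have [|V' sV' sUV'] := exD t U sUD; first by rewrite UX0 sub0mx.
rewrite -[U](subrK (V' *m Y)) addmx_sub ?submxMr //.
apply: submx_trans (submxMr Y (leD t)).
apply: IHm => //; last by rewrite mulmxBl UX0 -mulmxA YX0 mulmx0 subr0.
by rewrite subnS prednK ?subn_gt0.
Qed.

Lemma comm_mxZ (k : fieldType) n (a : k) (A B : 'M_n) :
  comm_mx A B -> comm_mx A (a *: B).
Proof. by rewrite /comm_mx -scalemxAl -scalemxAr => ->. Qed.

Lemma mx_exprZn (k : fieldType) n (a : k) (A : 'M_n) i :
  (a *: A) ^+ i = a ^+ i *: A ^+ i.
Proof.
elim: i => [|i IHi]; first by rewrite !expr0 scale1r.
by rewrite !exprS IHi -!mulmxE -scalemxAl -scalemxAr scalerA.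
Qed.

Section ShiftedElement.

Variables (k : fieldType) (p : nat) (gT : finGroupType) (G : {group gT}).
Hypotheses (char_k : p \in [pchar k]) (abelG : p.-abelem G).
Variables (E : {group gT}) (a : gT -> k).
Hypothesis sEG : E \subset G.

Let p_pr : prime p := pcharf_prime char_k.
Let p_gt0 : (0 < p)%N := prime_gt0 p_pr.

(** The action of X. The sum runs over all of E, so that no basis of E has to be chosen. *)
Definition shift_mx n (rG : mx_representation k G n) : 'M[k]_n :=
  \sum_(e in E) a e *: (rG e - 1%:M).

Lemma shift_mx_hom n1 n2 (r1 : mx_representation k G n1)
    (r2 : mx_representation k G n2) (f : 'M_(n1, n2)) :
    (forall g, g \in G -> r1 g *m f = f *m r2 g) ->
  shift_mx r1 *m f = f *m shift_mx r2.
Proof.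
move=> homf; rewrite mulmx_suml mulmx_sumr; apply: eq_bigr => e Ee.
by rewrite -scalemxAl -scalemxAr mulmxBl mulmxBr homf ?(subsetP sEG) // mul1mx mulmx1.
Qed.

Lemma shift_mx_fixed n m (rG : mx_representation k G n) (U : 'M_(m, n)) :
  (forall e, e \in E -> U *m rG e = U) -> U *m shift_mx rG = 0.
Proof.
move=> fixU; rewrite mulmx_sumr big1 // => e Ee.
by rewrite -scalemxAr mulmxBr fixU // mulmx1 subrr scaler0.
Qed.

Section OneModule.

Variables (n : nat) (rG : mx_representation k G n).
Local Notation J := (aug_pow rG).
Local Notation X := (shift_mx rG).

Lemma shift_mx_comm g : g \in G -> rG g *m X = X *m rG g.
Proof. by move=> Gg; apply/esym/shift_mx_hom => x Gx; apply: (repr_mx_comm abelG). Qed.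

Lemma shift_mx_expr_p : X ^+ p = 0.
Proof.
rewrite (mx_pFrobenius_sum char_k) => [|x y Ex Ey]; last first.
  apply: comm_mxZ; apply/comm_mx_sym/comm_mxZ; apply/comm_mxB/comm_mx1.
  apply/comm_mx_sym/comm_mxB/comm_mx1.
  by apply: (repr_mx_comm abelG); apply: (subsetP sEG).
rewrite big1 // => e Ee; rewrite mx_exprZn (repr_mxB1_expr_p char_k abelG) ?scaler0 //.
exact: (subsetP sEG).
Qed.

Variables (W : {group gT}) (e0 : gT) (c : gT -> nat).
Hypotheses (sWG : W \subset G) (Ge0 : e0 \in G).
Hypothesis cP : forall e, e \in E -> (e0 ^- c e * e)%g \in W.
Hypothesis c_nz : \sum_(e in E) a e * (c e)%:R != 0.

Let eps : 'M_n := rG e0 - 1.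
(** Write e = e0^(c e) w with w in W. Modulo J_W, e - 1 is [eps] times 1 + e0 + ... + e0^(c e - 1),
    so X acts as [eps *m eta] on the J_W-adic graded pieces. *)
Let eta : 'M_n := \sum_(e in E) a e *: \sum_(l < c e) rG e0 ^+ l.
Let zeta : 'M_n := ((\sum_(e in E) a e * (c e)%:R) ^- p) *: eta ^+ p.-1.

Let eta_comm (M : 'M_n) : comm_mx M (rG e0) -> comm_mx M eta.
Proof.
move=> cM; apply: comm_mx_sum => e _; apply: comm_mxZ.
by apply: comm_mx_sum => l _; apply: commrX.
Qed.

(** As e0^p = 1 and Frobenius is additive on commuting matrices, eta^p is the scalar (sum of the a_e
    c_e)^p, which is nonzero; hence [eta] is a unit. *)
Let eta_zeta : eta *m zeta = 1.
Proof.
rewrite -scalemxAr mulmxE -exprS prednK // (mx_pFrobenius_sum char_k) => [|x y _ _]; last first.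
  apply: comm_mxZ; apply: comm_mx_sym; apply: comm_mxZ.
  apply: comm_mx_sum => l _; apply: comm_mx_sym; apply: comm_mx_sum => l' _.
  by apply: commrX; apply: commr_sym; apply: commrX.
have -> : \sum_(e in E) (a e *: \sum_(l < c e) rG e0 ^+ l) ^+ p
          = \sum_(e in E) ((a e * (c e)%:R) ^+ p)%:M.
  apply: eq_bigr => e _; rewrite mx_exprZn (mx_pFrobenius_sum char_k); last first.
    by move=> l l' _ _; apply: commrX; apply: commr_sym; apply: commrX.
  under eq_bigr => l _ do rewrite exprAC (repr_mx_expr_p char_k abelG) // expr1n.
  rewrite sumr_const card_ord exprMn -scale_scalar_mx; congr (_ *: _).
  by rewrite -!(pFrobenius_autE char_k) pFrobenius_aut_nat raddfMn.
rewrite -(raddf_sum (@scalar_mx k n)) scale_scalar_mx.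
rewrite -(rmorph_sum (pFrobenius_aut char_k)) /= pFrobenius_autE.
by rewrite mulVf ?expf_neq0.
Qed.

Let eps_comm : comm_mx eps (rG e0).
Proof. by apply/comm_mx_sym/comm_mxB/comm_mx1/comm_mx_refl. Qed.

Let shift_eps m t (U : 'M_(m, n)) :
  (U <= J W t)%MS -> (U *m X - U *m (eps *m eta) <= J W t.+1)%MS.
Proof.
move=> sU; rewrite -mulmxBr mulmx_sumr -sumrB mulmx_sumr summx_sub // => e Ee.
rewrite -scalemxAr -scalerBr -scalemxAr scalemx_sub //.
have Ww := cP Ee; set w := (_ * _)%g in Ww.
have {1}-> : e = (e0 ^+ c e * w)%g by rewrite /w mulKVg.
rewrite (repr_mxB1_split abelG) ?(subsetP sWG w Ww) // -/eps addrK mulmxA.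
apply: submx_trans (aug_pow_mulr abelG _ _ sWG (groupX _ Ge0)).
by apply: submxMr; apply: aug_powS_sub.
Qed.

Let stab (M : 'M_n) m (U : 'M_(m, n)) t :
    (forall g, g \in G -> comm_mx (rG g) M) -> (U <= J W t)%MS ->
  (U *m M <= J W t)%MS.
Proof.
move=> cM sU; apply: submx_trans (submxMr M sU) _.
by apply: aug_pow_stable => g Wg; apply: cM; apply: (subsetP sWG).
Qed.

Let cent_e0 g : g \in G -> comm_mx (rG g) (rG e0).
Proof. by move=> Gg; apply: (repr_mx_comm abelG). Qed.

Let cent_eps g : g \in G -> comm_mx (rG g) eps.
Proof. by move=> Gg; apply/comm_mxB/comm_mx1/cent_e0. Qed.

Let cent_eta g : g \in G -> comm_mx (rG g) eta.
Proof. by move=> Gg; apply/eta_comm/cent_e0. Qed.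

Let cent_zeta g : g \in G -> comm_mx (rG g) zeta.
Proof. by move=> Gg; apply: comm_mxZ; apply: commrX; apply: cent_eta. Qed.

Let comm_eps_eta : comm_mx eps eta.
Proof. exact/eta_comm/eps_comm. Qed.

Let comm_eta_zeta : comm_mx eta zeta.
Proof. exact/comm_mxZ/commrX/comm_mx_refl. Qed.

Let comm_eps_zeta : comm_mx eps zeta.
Proof. exact/comm_mxZ/commrX. Qed.

Let shift_epsX m t (U : 'M_(m, n)) i : (U <= J W t)%MS ->
  (U *m X ^+ i - U *m (eps ^+ i *m eta ^+ i) <= J W t.+1)%MS.
Proof.
move=> sU; elim: i => [|i IHi]; first by rewrite !expr0 !mulmx1 subrr sub0mx.
have -> : U *m X ^+ i.+1 - U *m (eps ^+ i.+1 *m eta ^+ i.+1)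
  = (U *m X ^+ i *m X - U *m X ^+ i *m (eps *m eta))
    + (U *m X ^+ i - U *m (eps ^+ i *m eta ^+ i)) *m (eps *m eta).
  rewrite (mulmxBl (U *m X ^+ i)) addrA subrK !exprSr -!mulmxE -!mulmxA; congr (_ - _ *m (_ *m _)).
  by rewrite !mulmxA; congr (_ *m _); apply/esym; apply: commr_sym; apply: commrX.
rewrite addmx_sub //.
  apply: shift_eps; apply: stab => // g Gg; apply: commrX; exact: shift_mx_comm.
by apply: stab => // g Gg; apply: comm_mxM; [apply: cent_eps | apply: cent_eta].
Qed.

(** An abstract form of [coset_proj F W]: a W-linear map whose relative trace over <e0> is the
    identity. It makes the graded pieces free over <e0>. *)
Variable P : 'M[k]_n.
Hypotheses (nt_e0 : e0 != 1%g).
Hypothesis cPW : forall w, w \in W -> rG w *m P = P *m rG w.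
Hypothesis sumP : \sum_(x in <[e0]>%g) rG x^-1%g *m P *m rG x = 1%:M.

Let stabP m t (U : 'M_(m, n)) : (U <= J W t)%MS -> (U *m P <= J W t)%MS.
Proof. by move=> sU; apply: submx_trans (submxMr P sU) (aug_pow_stable _ _). Qed.

Let stabX m t (U : 'M_(m, n)) x :
  x \in G -> (U <= J W t)%MS -> (U *m rG x <= J W t)%MS.
Proof. by move=> Gx; apply: stab => g Gg; apply: (repr_mx_comm abelG). Qed.

Let stab_sumX m t (U : 'M_(m, n)) i :
  (U <= J W t)%MS -> (U *m (\sum_(l < i) rG e0 ^+ l) <= J W t)%MS.
Proof. by apply: stab => g Gg; apply: (repr_mx_comm_sumX abelG). Qed.

(** As U [eps] lies in the next layer, so does U x^-1 - U for x in <e0>. Therefore U, the sum of the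
    U x^-1 P x, agrees with U P times the norm of <e0>, which is [eps ^+ p.-1]. *)
Let gr_kernel m t (U : 'M_(m, n)) :
    (U <= J W t)%MS -> (U *m eps <= J W t.+1)%MS ->
  (U - U *m P *m eps ^+ p.-1 <= J W t.+1)%MS.
Proof.
move=> sU sUe.
rewrite -{1}[U]mulmx1 -sumP -(sum_repr_mx_cycle char_k abelG) // !mulmx_sumr.
rewrite -sumrB summx_sub // => x e0x.
have -> : U *m (rG x^-1%g *m P *m rG x) - U *m P *m rG x
          = U *m (rG x^-1%g - 1) *m P *m rG x.
  by rewrite !mulmxA mulmxBr !mulmxBl mulmx1.
have Gx : x \in G by apply: subsetP e0x; rewrite cycle_subG.
apply: stabX => //; apply: stabP.
have /cycleP[j ->] : (x^-1)%g \in <[e0]>%g by rewrite groupV.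
rewrite repr_mxX_gen // subrX1 -mulmxE mulmxA; exact: stab_sumX.
Qed.

(** Let V be the sum over i of U e0^-i P (1 + ... + e0^(i-1)). Then V [eps] is the sum of the U
    e0^-i P (e0^i - 1), that is, U - U N P with N the norm of <e0>; and U N lies in the next
    layer. *)
Let gr_cokernel m t (U : 'M_(m, n)) :
    (U <= J W t)%MS -> (U *m eps ^+ p.-1 <= J W t.+1)%MS ->
  exists2 V : 'M_(m, n), (V <= J W t)%MS & (U - V *m eps <= J W t.+1)%MS.
Proof.
move=> sU; rewrite -(sum_repr_mx_cycle char_k abelG) // => sUS.
have sumPX: \sum_(i < #[e0]%g) rG (e0 ^+ i)^-1%g *m P *m rG (e0 ^+ i)%g = 1%:M.
  by rewrite -sumP sum_cycle.
have GX i : (e0 ^+ i)%g \in G by rewrite groupX.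
exists (\sum_(i < #[e0]%g)
          U *m rG (e0 ^+ i)^-1%g *m P *m \sum_(l < i) rG e0 ^+ l).
  rewrite summx_sub // => i _; apply: stab_sumX; apply: stabP; apply: stabX => //.
  by rewrite groupV.
have -> : U - (\sum_(i < #[e0]%g)
      U *m rG (e0 ^+ i)^-1%g *m P *m \sum_(l < i) rG e0 ^+ l) *m eps
    = U *m (\sum_(x in <[e0]>%g) rG x) *m P.
  rewrite -{1}[U]mulmx1 -sumPX mulmx_sumr mulmx_suml -sumrB.
  rewrite (reindex_inj invg_inj) /= mulmx_sumr mulmx_suml.
  under [in RHS]eq_bigl => x do rewrite groupV.
  rewrite sum_cycle; apply: eq_bigr => i _.
  have sumE: (\sum_(l < i) rG e0 ^+ l) *m eps = rG (e0 ^+ i)%g - 1.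
    rewrite repr_mxX_gen // subrX1 -mulmxE; apply/esym/comm_mx_sum => l _.
    exact/commrX/eps_comm.
  rewrite -[_ *m _ *m eps]mulmxA sumE mulmxBr !mulmxA mulmx1.
  by rewrite opprB addrC subrK.
exact: stabP.
Qed.

Lemma shift_mx_kernel m t (U : 'M_(m, n)) T : J W T = 0 ->
  (U <= J W t)%MS -> U *m X = 0 -> (U <= J W t *m X ^+ p.-1)%MS.
Proof.
move=> JT0; apply: (filtered_exact JT0) => [i||i V sV sVX].
- exact: aug_powS_le.
- by rewrite mulmxE -exprSr prednK // shift_mx_expr_p.
have sVe : (V *m eps <= J W i.+1)%MS.
  have -> : V *m eps = V *m (eps *m eta) *m zeta.
    by rewrite -!mulmxA eta_zeta mulmx1.
  apply: stab => //; rewrite -[V *m _](subrK (V *m X)) addmx_sub //.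
  by rewrite -opprB eqmx_opp shift_eps.
(* The leading term of X^(p-1) is eps^(p-1) eta^(p-1), and the power of [zeta] cancels the unit in
   it. *)
exists (V *m P *m zeta ^+ p.-1).
  by apply: stab => [g Gg|]; [exact/commrX/cent_zeta | exact: stabP].
have sV' : (V *m P *m zeta ^+ p.-1 <= J W i)%MS.
  by apply: stab => [g Gg|]; [exact/commrX/cent_zeta | exact: stabP].
rewrite -{1}(subrK (V *m P *m eps ^+ p.-1) V) -addrA addmx_sub ?gr_kernel //.
have -> : V *m P *m eps ^+ p.-1
    = V *m P *m zeta ^+ p.-1 *m (eps ^+ p.-1 *m eta ^+ p.-1).
  rewrite -!mulmxA; congr (_ *m (_ *m _)); rewrite !mulmxE mulrA.
  have -> : zeta ^+ p.-1 * eps ^+ p.-1 = eps ^+ p.-1 * zeta ^+ p.-1.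
    by apply: commrX; apply: commr_sym; apply: commrX; exact: comm_eps_zeta.
  rewrite -mulrA -exprMn_comm; last exact/comm_mx_sym.
  by rewrite -mulmxE -comm_eta_zeta eta_zeta expr1n mulmx1.
by rewrite -opprB eqmx_opp shift_epsX.
Qed.

Lemma shift_mx_cokernel m t (U : 'M_(m, n)) T : J W T = 0 ->
  (U <= J W t)%MS -> U *m X ^+ p.-1 = 0 -> (U <= J W t *m X)%MS.
Proof.
move=> JT0; apply: (filtered_exact JT0) => [i||i V sV sVX].
- exact: aug_powS_le.
- by rewrite mulmxE -exprS prednK // shift_mx_expr_p.
have sVe : (V *m eps ^+ p.-1 <= J W i.+1)%MS.
  have -> : V *m eps ^+ p.-1 = V *m (eps ^+ p.-1 *m eta ^+ p.-1) *m zeta ^+ p.-1.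
    rewrite -!mulmxA; congr (_ *m _).
    by rewrite !mulmxE -exprMn_comm // -mulmxE eta_zeta expr1n mulmx1.
  apply: stab => [g Gg|]; first exact/commrX/cent_zeta.
  rewrite -[V *m _](subrK (V *m X ^+ p.-1)) addmx_sub //.
  by rewrite -opprB eqmx_opp shift_epsX.
have [V1 sV1 sVV1] := gr_cokernel sV sVe.
have sV1z : (V1 *m zeta <= J W i)%MS by apply: stab.
exists (V1 *m zeta) => //.
rewrite -{1}(subrK (V1 *m eps) V) -addrA addmx_sub //.
have -> : V1 *m eps = V1 *m zeta *m (eps *m eta).
  rewrite -!mulmxA; congr (_ *m _).
  by rewrite mulmxA -comm_eps_zeta -mulmxA -comm_eta_zeta eta_zeta mulmx1.
by rewrite -opprB eqmx_opp shift_eps.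
Qed.

End OneModule.
End ShiftedElement.

(** * The numerical form of the index hypothesis *)

Section IndexGap.

Variables (p : nat) (gT : finGroupType) (G : {group gT}) (H : {set {group gT}}).
Hypotheses (p_pr : prime p) (pG : p.-group G).
Hypothesis H_sub : forall E : {group gT}, E \in H -> E \subset G.
Hypothesis H_index : ~ exists E F : {group gT},
  [/\ E \in H, F \in H, E \subset F & #|F : E|%g = p].

Lemma log_card_sub (A B : {group gT}) : A \subset B -> B \subset G ->
  [/\ (logn p #|A| <= logn p #|B|)%N,
      logn p #|A| = logn p #|B| -> A = B &
      logn p #|B| = (logn p #|A|).+1 -> #|B : A|%g = p].
Proof.
move=> sAB sBG; have [pB pA] := (pgroupS sBG pG, pgroupS (subset_trans sAB sBG) pG).
have [oA oB] := (card_pgroup pA, card_pgroup pB); split.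
- by rewrite dvdn_leq_log ?cardG_gt0 ?cardSg.
- by move=> eq_log; apply/val_inj/eqP; rewrite eqEcard sAB /= oA oB eq_log leqnn.
- by move=> eq_log; rewrite -divgS // oA oB eq_log expnS mulnK //.
Qed.

(** If lg(E / E :&: F) + lg(F / E :&: F) were 0, then E = F; if it were 1, one of the two would
    contain the other with index p. *)
Lemma log_card_gap (E F : {group gT}) : E \in H -> F \in H -> E != F ->
  ((logn p #|E :&: F|).*2 + 2 <= logn p #|E| + logn p #|F|)%N.
Proof.
move=> HE HF neqEF.
have [leE eqE indE] := log_card_sub (subsetIl E F) (H_sub HE).
have [leF eqF indF] := log_card_sub (subsetIr E F) (H_sub HF).
have neqE: logn p #|E :&: F| = logn p #|E| -> logn p #|F| <> (logn p #|E :&: F|).+1.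
  move=> /eqE eqIE /indF; have eqIE': E :&: F = E := congr1 val eqIE.
  by rewrite /= eqIE' => indEF; case: H_index; exists E, F; split=> //; rewrite -eqIE' subsetIr.
have neqF: logn p #|E :&: F| = logn p #|F| -> logn p #|E| <> (logn p #|E :&: F|).+1.
  move=> /eqF eqIF /indE; have eqIF': E :&: F = F := congr1 val eqIF.
  by rewrite /= eqIF' => indEF; case: H_index; exists F, E; split=> //; rewrite -eqIF' subsetIl.
have neq: ~ (logn p #|E :&: F| = logn p #|E| /\ logn p #|E :&: F| = logn p #|F|).
  by case=> /eqE eqIE /eqF eqIF; case/eqP: neqEF; rewrite -eqIE.
by move: leE leF neqE neqF neq => /=; lia.
Qed.

End IndexGap.

(** * The functor of vectors of high weight *)

Section TopFiltration.

Variables (k : fieldType) (p : nat) (gT : finGroupType) (G : {group gT}).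
Hypotheses (char_k : p \in [pchar k]) (abelG : p.-abelem G).
Variables (H : {set {group gT}}).
Hypothesis H_sub : forall E : {group gT}, E \in H -> E \subset G.
Hypothesis H_index : ~ exists E F : {group gT},
  [/\ E \in H, F \in H, E \subset F & #|F : E|%g = p].
Variables (E : {group gT}) (a : gT -> k).
Hypothesis sEG : E \subset G.
(** In characteristic p this says that the [a e], for e in E, are linearly independent over the
    prime field. *)
Hypothesis generic_a : forall c : gT -> nat,
  (exists2 e, e \in E & (c e)%:R != 0 :> k) -> \sum_(e in E) a e * (c e)%:R != 0.

Let p_pr : prime p := pcharf_prime char_k.
Let p_gt0 : (0 < p)%N := prime_gt0 p_pr.
Local Notation R F := (coset_repr k G F).
Local Notation lg A := (logn p #|A|).
Local Notation X rG := (shift_mx E a rG).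

Definition transverse (F W : {group gT}) :=
  [&& W \subset G, F \subset W & [exists e0 in E,
    [&& e0 != 1%g, (<[e0]> * W)%g == G & <[e0]> :&: W == 1%g]]].

Lemma transverse_exists (F : {group gT}) : F \subset G -> ~~ (E \subset F) ->
  exists W, transverse F W.
Proof.
move=> sFG /subsetPn[e0 Ee0 Fe0].
have nt_e0: e0 != 1%g by apply: contraNneq Fe0 => ->; rewrite group1.
have Ge0 := subsetP sEG _ Ee0.
have tiF: (<[e0]> :&: F = 1)%g.
  by rewrite prime_TIg ?cycle_subG // -orderE (abelem_order_p abelG).
have [|W [sWG sFW defG tiW]] := abelem_TI_compl abelG _ sFG tiF.
  by rewrite cycle_subG.
exists W; rewrite /transverse sWG sFW /=; apply/existsP; exists e0.
by rewrite Ee0 nt_e0 defG tiW !eqxx.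
Qed.

(** The least t with t + (p-1) lg(F)/2 >= (p-1) (lg(G) - lg(E)/2); [uphalf] rounds up. *)
Definition top_deg (F : {group gT}) : nat :=
  uphalf (p.-1 * ((lg G).*2 - lg E - lg F)).

(* The part of J_W-adic weight at least [(p-1) (lg G - lg E / 2)], which is the
   weight of the socle of k[G/E]. There is no transverse W when F contains E. *)
Definition top_filt (F : {group gT}) : 'M[k]_#|rcosets F G| :=
  if [pick W | transverse F W] is Some W then aug_pow (R F) W (top_deg F) else 0.

(** The term [p.-1.*2] pays for the passage from J_G to J_W in [aug_pow_step]. *)
Lemma aug_pow_top_filt (F : {group gT}) m : F \subset G ->
    (p.-1 * ((lg G).*2 - lg E - lg F) + p.-1.*2 <= m.*2)%N ->
  (aug_pow (R F) G m <= top_filt F)%MS.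
Proof.
move=> sFG lem; rewrite /top_filt; case: pickP => [W /and3P[sWG sFW] | noW].
  case/existsP=> e0 /and4P[Ee0 _ /eqP defG _].
  apply: submx_trans (_ : (aug_pow (R F) G (top_deg F + p.-1) <= _)%MS).
    by apply: aug_pow_leq; rewrite /top_deg; lia.
  apply: (aug_pow_step char_k abelG _ _ (subxx G) sWG (subsetP sEG _ Ee0)).
  by rewrite defG.
(* Here F contains E, so m > (p-1) lg(G/F) and the left-hand side is already 0. *)
have [sEF | nsEF] := boolP (E \subset F); last first.
  by have [W tW] := transverse_exists sFG nsEF; rewrite noW in tW.
rewrite (aug_pow_coset_max char_k abelG) // -divgS // logn_div ?cardSg //.
have leFG: (lg F <= lg G)%N by rewrite dvdn_leq_log ?cardG_gt0 ?cardSg.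
have leEF: (lg E <= lg F)%N by rewrite dvdn_leq_log ?cardG_gt0 ?cardSg.
have p1_gt0 : (0 < p.-1)%N by rewrite -subn1 subn_gt0 prime_gt1.
nia.
Qed.

Lemma top_filt_aug_pow (F : {group gT}) :
  (top_filt F <= aug_pow (R F) G (top_deg F))%MS.
Proof.
rewrite /top_filt; case: pickP => [W /and3P[sWG _ _] | _]; last exact: sub0mx.
exact: aug_pow_sub.
Qed.

(** By [log_card_gap], [f] raises the weight by at least p - 1, exactly what [aug_pow_top_filt]
    requires. Hence [U] need only have large J_G-adic weight. *)
Lemma hom_into_top_filt (F1 F2 : {group gT}) (f : 'M_(_, _)) m
    (U : 'M_(m, #|rcosets F1 G|)) s :
    F1 \in H -> F2 \in H -> F1 != F2 -> kG_hom (V := R F1) (W := R F2) f ->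
    (p.-1 * ((lg G).*2 - lg E - lg F1) <= s.*2)%N ->
    (U <= aug_pow (R F1) G s)%MS ->
  (U *m f <= top_filt F2)%MS.
Proof.
move=> HF1 HF2 neqF homf les sU; have [sF1 sF2] := (H_sub HF1, H_sub HF2).
have gap := log_card_gap p_pr (abelem_pgroup abelG) H_sub H_index HF1 HF2 neqF.
apply: submx_trans (submxMr f sU) _.
have := coset_hom_sub_aug_pow char_k abelG sF1 sF2 homf.
move/(aug_pow_hom (r1 := R F1) s homf)=> le1; apply: submx_trans le1 _.
apply: aug_pow_top_filt => //.
rewrite -divgS ?subsetIl // logn_div ?cardSg ?subsetIl //.
have leF1: (lg F1 <= lg G)%N by rewrite dvdn_leq_log ?cardG_gt0 ?cardSg.
have leF2: (lg F2 <= lg G)%N by rewrite dvdn_leq_log ?cardG_gt0 ?cardSg.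
have leE: (lg E <= lg G)%N by rewrite dvdn_leq_log ?cardG_gt0 ?cardSg.
have leI: (lg (F1 :&: F2) <= lg F1)%N.
  by rewrite dvdn_leq_log ?cardG_gt0 ?cardSg ?subsetIl.
rewrite doubleD doubleMr; apply: leq_trans (leq_add les (leqnn _)).
rewrite -[p.-1.*2]muln2 -!mulnDr leq_mul2l.
apply/orP; right; move: gap leI leF1 leF2 leE => /=.
move: (lg G) (lg E) (lg F1) (lg F2) (lg (F1 :&: F2)%SET) => n e f1 f2 i. lia.
Qed.

(** For F1 <> F2 the choices of W may be unrelated, but the map factors through the J_G-adic
    estimate. For F1 = F2 both sides use the same W. *)
Lemma top_filt_hom (F1 F2 : {group gT}) (f : 'M_(_, _)) :
    F1 \in H -> F2 \in H -> kG_hom (V := R F1) (W := R F2) f ->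
  (top_filt F1 *m f <= top_filt F2)%MS.
Proof.
move=> HF1 HF2; have [eqF | neqF] := eqVneq F1 F2; last first.
  move=> homf; apply: hom_into_top_filt (top_filt_aug_pow F1) => //.
  by rewrite /top_deg; lia.
rewrite -{F2 HF2}eqF in f * => homf; rewrite /top_filt.
case: pickP => [W /and3P[sWG _ _] | _]; last by rewrite mul0mx sub0mx.
by apply: aug_pow_stable => g Wg; apply: homf; apply: (subsetP sWG).
Qed.

(** Freeness over k[X]/(X^p), in two halves: for [b] true the kernel of X lies in the image of
    X^(p-1), for [b] false the roles are exchanged. *)
Lemma top_filt_exact (F : {group gT}) m (U : 'M_(m, #|rcosets F G|)) (b : bool) :
    F \subset G -> (U <= top_filt F)%MS ->
    U *m X (R F) ^+ (if b then 1 else p.-1)%N = 0 ->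
  (U <= top_filt F *m X (R F) ^+ (if b then p.-1 else 1)%N)%MS.
Proof.
move=> sFG; rewrite /top_filt; case: pickP => [W /and3P[sWG sFW] | _]; last first.
  by rewrite submx0 => /eqP-> _; apply: sub0mx.
case/existsP=> e0 /and4P[Ee0 nt_e0 /eqP defG /eqP tiW] sU.
have Ge0 := subsetP sEG _ Ee0.
(* The exponent of the <e0>-component of e in G = <e0> \x W. *)
pose c e := find (fun i => (e0 ^- i * e)%g \in W) (iota 0 #[e0]%g).
have cP e : e \in E -> (e0 ^- c e * e)%g \in W.
  move=> Ee; have : e \in (<[e0]> * W)%g by rewrite defG (subsetP sEG).
  case/mulsgP=> _ w /cyclePmin[i lti ->] Ww defe.
  have hasW: has (fun i => (e0 ^- i * e)%g \in W) (iota 0 #[e0]%g).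
    apply/hasP; exists i; first by rewrite mem_iota.
    by rewrite defe mulKg.
  have := nth_find 0%N hasW; rewrite nth_iota //.
  by move: hasW; rewrite has_find size_iota.
(* The exponent of e0 itself is prime to p: otherwise e0^(c e0) = 1 and e0 would lie in W. *)
have c_nz: \sum_(e in E) a e * (c e)%:R != 0.
  apply: generic_a; exists e0 => //; rewrite -(dvdn_pcharf char_k).
  apply/negP=> /dvdnP[q defc]; have := cP e0 Ee0.
  have [_ expG] := abelemP p_pr abelG.
  rewrite defc mulnC expgM expG // expg1n invg1 mul1g => We0.
  case/negP: nt_e0; rewrite -in_set1 -[[set 1%g]]/(1%g : {set gT}) -tiW inE We0.
  by rewrite cycle_id.
have JT0: aug_pow (R F) W (p.-1 * logn p #|G : F|).+1 = 0.
  apply/eqP; rewrite -submx0; apply: submx_trans (aug_pow_sub _ _ sWG) _.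
  by rewrite (aug_pow_coset_max char_k abelG).
have cW w : w \in W -> R F w *m coset_proj k G F W = coset_proj k G F W *m R F w.
  exact: coset_proj_comm.
have sumP := coset_proj_sum k abelG sFW sWG defG tiW.
case: b; rewrite ?expr1 => UX0.
  exact: (shift_mx_kernel char_k abelG sEG sWG Ge0 cP c_nz nt_e0 cW sumP JT0).
exact: (shift_mx_cokernel char_k abelG sEG sWG Ge0 cP c_nz nt_e0 cW sumP JT0).
Qed.

End TopFiltration.

(** * The zigzag argument *)

Section Homs.

Variables (k : fieldType) (gT : finGroupType) (G : {group gT}).
Implicit Types U V W : representation k G.

Lemma kG_hom1 V : kG_hom (V := V) (W := V) 1%:M.
Proof. by move=> g _; rewrite mulmx1 mul1mx. Qed.

Lemma kG_hom_comp U V W (f : 'M_(rdegree U, rdegree V)) (h : 'M_(rdegree V, rdegree W)) :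
  kG_hom f -> kG_hom h -> kG_hom (V := U) (W := W) (f *m h).
Proof. by move=> homf homh g Gg; rewrite mulmxA homf // -!mulmxA homh. Qed.

Lemma kG_hom0 V W : kG_hom (V := V) (W := W) 0.
Proof. by move=> g _; rewrite mulmx0 mul0mx. Qed.

Lemma kG_homZ V W c (f : 'M_(rdegree V, rdegree W)) :
  kG_hom f -> kG_hom (V := V) (W := W) (c *: f).
Proof. by move=> homf g Gg; rewrite -scalemxAr -scalemxAl homf. Qed.

Lemma kG_hom_sum V W (I : finType) (f : I -> 'M_(rdegree V, rdegree W)) :
  (forall i, kG_hom (f i)) -> kG_hom (V := V) (W := W) (\sum_i f i).
Proof.
move=> homf g Gg; rewrite mulmx_sumr mulmx_suml.
by apply: eq_bigr => i _; apply: homf.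
Qed.

End Homs.

Section PermDecomp.

Variables (k : fieldType) (gT : finGroupType) (G : {group gT}).
Local Notation R F := (coset_repr k G F).

(** Biproduct data replace an isomorphism with an iterated sum, so that summands are reached by
    matrices and no degree has to be transported. *)
Record perm_decomp (V : representation k G) (I : finType) (F : I -> {group gT}) :=
  PermDecomp {
    inj_mx : forall i, 'M[k]_(rdegree (R (F i)), rdegree V);
    prj_mx : forall i, 'M[k]_(rdegree V, rdegree (R (F i)));
    inj_mx_hom : forall i, kG_hom (inj_mx i);
    prj_mx_hom : forall i, kG_hom (prj_mx i);
    inj_prj_id : forall i, inj_mx i *m prj_mx i = 1%:M;
    inj_prj_neq : forall i j, i != j -> inj_mx i *m prj_mx j = 0;
    sum_prj_inj : \sum_i prj_mx i *m inj_mx i = 1%:M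
  }.

Definition perm_sum (H : {set {group gT}}) (V : representation k G) : Prop :=
  exists (I : finType) (F : I -> {group gT}),
    (forall i, F i \in H) /\ inhabited (perm_decomp V F).

Lemma decomp_row (V : representation k G) (I : finType) (F : I -> {group gT})
    (d : perm_decomp V F) m (U : 'M_(m, rdegree V)) :
  U = \sum_i U *m prj_mx d i *m inj_mx d i.
Proof.
rewrite -[LHS]mulmx1 -(sum_prj_inj d) mulmx_sumr.
by apply: eq_bigr => i _; rewrite mulmxA.
Qed.

End PermDecomp.

Section ZigZag.

Variables (k : fieldType) (p : nat) (gT : finGroupType) (G : {group gT}).
Hypotheses (char_k : p \in [pchar k]) (abelG : p.-abelem G).
Variables (H : {set {group gT}}).
Hypothesis H_sub : forall E : {group gT}, E \in H -> E \subset G.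
Hypothesis H_index : ~ exists E F : {group gT},
  [/\ E \in H, F \in H, E \subset F & #|F : E|%g = p].
Variables (E : {group gT}) (a : gT -> k).
Hypothesis HE : E \in H.
Hypothesis generic_a : forall c : gT -> nat,
  (exists2 e, e \in E & (c e)%:R != 0 :> k) -> \sum_(e in E) a e * (c e)%:R != 0.

Let sEG := H_sub HE.
Let p_pr : prime p := pcharf_prime char_k.
Let p_gt0 : (0 < p)%N := prime_gt0 p_pr.
Local Notation R F := (coset_repr k G F).
Local Notation X V := (shift_mx E a (mx_repr_of_repr V)).
Local Notation top F := (top_filt k p G E F).

(** X^(p-1) for [b] true and X for [b] false: the zigzag alternates between them, and their product
    is X^p = 0. *)
Definition shiftX (V : representation k G) (b : bool) : 'M_(rdegree V) :=
  X V ^+ (if b then p.-1 else 1)%N.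

Lemma shiftX_hom (V W : representation k G) (f : 'M_(rdegree V, rdegree W)) b :
  kG_hom f -> shiftX V b *m f = f *m shiftX W b.
Proof.
move=> homf; rewrite /shiftX; elim: (if b then _ else _) => [|i IHi].
  by rewrite !expr0 mul1mx mulmx1.
rewrite !exprS -!mulmxE -mulmxA IHi !mulmxA; congr (_ *m _).
exact: (shift_mx_hom a sEG).
Qed.

Lemma shiftX_mul (V : representation k G) b : shiftX V b *m shiftX V (~~ b) = 0.
Proof.
rewrite /shiftX mulmxE -exprD; case: b => /=; rewrite ?addn1 ?add1n prednK //.
all: exact: (shift_mx_expr_p char_k abelG).
Qed.

(* Unlike [top_filt], this is defined without reference to a decomposition of V
   as a sum of permutation modules, hence is functorial. *)
Definition in_top (V : representation k G) (v : 'rV_(rdegree V)) : Prop :=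
  forall F (f : 'M_(rdegree V, rdegree (R F))), F \in H -> kG_hom f ->
    (v *m f <= top F)%MS.

Lemma in_top_hom (V W : representation k G) (f : 'M_(rdegree V, rdegree W)) v :
  kG_hom f -> in_top v -> in_top (v *m f).
Proof.
by move=> homf Dv F h HF homh; rewrite -mulmxA; apply: Dv => //; apply: kG_hom_comp.
Qed.

Lemma in_topP (V : representation k G) (I : finType) (F : I -> {group gT})
    (d : perm_decomp V F) (v : 'rV_(rdegree V)) :
    (forall i, F i \in H) ->
  (forall i, (v *m prj_mx d i <= top (F i))%MS) -> in_top v.
Proof.
move=> HF Dv F' f HF' homf; rewrite (decomp_row d v) mulmx_suml.
rewrite summx_sub // => i _; rewrite -mulmxA.
apply: submx_trans (submxMr _ (Dv i)) _; apply: (top_filt_hom char_k abelG H_sub H_index) => //.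
by apply: kG_hom_comp homf; apply: inj_mx_hom.
Qed.

Lemma in_top_exact (V : representation k G) (v : 'rV_(rdegree V)) b :
    perm_sum H V -> in_top v -> v *m shiftX V b = 0 ->
  exists2 u, in_top u & v = u *m shiftX V (~~ b).
Proof.
case=> I [F [HF [d]]] Dv vX0.
have leT i : (v *m prj_mx d i <= top (F i) *m shiftX (R (F i)) (~~ b))%MS.
  apply: (top_filt_exact char_k abelG sEG generic_a) => //.
  - exact: H_sub.
  - exact: Dv (prj_mx_hom d i).
  have := shiftX_hom b (prj_mx_hom d i); rewrite if_neg /shiftX => hX.
  by rewrite -mulmxA -hX mulmxA vX0 mul0mx.
pose u i := v *m prj_mx d i *m pinvmx (top (F i) *m shiftX (R (F i)) (~~ b)) *m top (F i).
have uP i : u i *m shiftX (R (F i)) (~~ b) = v *m prj_mx d i.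
  by rewrite -[u i *m _]mulmxA mulmxKpV.
exists (\sum_i u i *m inj_mx d i).
  move=> F' f HF' homf; rewrite mulmx_suml summx_sub // => i _.
  rewrite -mulmxA /u -[_ *m top _ *m _]mulmxA; apply: submx_trans (submxMl _ _) _.
  apply: (top_filt_hom char_k abelG H_sub H_index) => //.
  by apply: kG_hom_comp homf; apply: inj_mx_hom.
rewrite mulmx_suml {1}(decomp_row d v); apply: eq_bigr => i _.
by rewrite -[u i *m _ *m _]mulmxA -(shiftX_hom _ (inj_mx_hom d i)) mulmxA uP.
Qed.

Variables (l : nat) (C : cochain_complex k G).
Hypotheses (C_bounded : bounded_by l C) (C_exact : exact C).
Hypothesis C_perm : forall i, perm_sum H (C i).

Lemma exact_row i (w : 'rV_(rdegree (C i.+1))) :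
  w *m cdiff C i.+1 = 0 -> exists v, w = v *m cdiff C i.
Proof.
move=> /eqP; rewrite -sub_kermx => sw; apply/submxP; apply: submx_trans sw _.
by case: C_exact => _ /(_ i)/andP[].
Qed.

Lemma exact_row0 (w : 'rV_(rdegree (C 0))) : w *m cdiff C 0 = 0 -> w = 0.
Proof.
move=> /eqP; rewrite -sub_kermx => sw; apply/eqP; rewrite -submx0.
by apply: submx_trans sw _; case: C_exact => /andP[].
Qed.

(** u d is killed by [shiftX b], since u [shiftX b] = w d and d d = 0; so it can be divided by the
    other power of X. *)
Lemma zigzag_next i (u : 'rV_(rdegree (C i.+1))) (w : 'rV_(rdegree (C i))) b :
    in_top u -> w *m cdiff C i = u *m shiftX (C i.+1) b ->
  exists2 u', in_top u' & u *m cdiff C i.+1 = u' *m shiftX (C i.+2) (~~ b).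
Proof.
move=> Du defw; apply: in_top_exact => //.
  by apply: in_top_hom Du; apply: cdiff_hom.
rewrite -mulmxA -(shiftX_hom _ (@cdiff_hom _ _ _ C i.+1)) mulmxA -defw.
by rewrite -mulmxA cdiff_comp mulmx0.
Qed.

(** Downward induction on the degree. Write u d = u' [shiftX (~~ b)]; by induction u = v
    [shiftX (~~ b)] + v' d. Then w - v' [shiftX b] is a cocycle, hence a coboundary. *)
Lemma zigzag i (u : 'rV_(rdegree (C i.+2))) (w : 'rV_(rdegree (C i.+1))) b :
    in_top u -> w *m cdiff C i.+1 = u *m shiftX (C i.+2) b ->
  exists v v', w = v *m shiftX (C i.+1) b + v' *m cdiff C i.
Proof.
have [m] := ubnP (l - i); elim: m i u w b => // m IHm i u w b ltm Du defw.
have [u' Du' defu] := zigzag_next Du defw.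
have [v [v' defu2]] : exists v v', u = v *m shiftX (C i.+2) (~~ b) + v' *m cdiff C i.+1.
  (* The induction starts where degree i + 2 exceeds l: there the module is 0 and so is u. *)
  have [leil | ltil] := leqP l i.+1; last first.
    by apply: IHm Du' defu; lia.
  exists 0, 0; rewrite !mul0mx addr0; have n0: rdegree (C i.+2) = 0%N by apply: C_bounded.
  by apply/rowP=> j; move: (ltn_ord j); rewrite {2}n0.
exists v'.
have /exact_row[v'' defw'] : (w - v' *m shiftX (C i.+1) b) *m cdiff C i.+1 = 0.
  rewrite mulmxBl defw defu2 mulmxDl -!mulmxA.
  have := shiftX_mul (C i.+2) (~~ b); rewrite negbK => ->.
  by rewrite mulmx0 add0r shiftX_hom ?subrr //; apply: cdiff_hom.
by exists v''; rewrite -defw' addrC subrK.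
Qed.

(** The same unwinding in degree 0, where d is injective and no coboundary term remains. *)
Lemma zigzag0 (z : 'rV_(rdegree (C 0))) b :
    in_top (z *m cdiff C 0) -> z *m shiftX (C 0) (~~ b) = 0 ->
  exists v, z = v *m shiftX (C 0) b.
Proof.
move=> Dz zX0.
have [u Du defz]: exists2 u, in_top u & z *m cdiff C 0 = u *m shiftX (C 1) b.
  have [|u Du defz] := in_top_exact (b := ~~ b) (C_perm 1) Dz.
    by rewrite -mulmxA -shiftX_hom ?mulmxA ?zX0 ?mul0mx //; apply: cdiff_hom.
  by exists u; rewrite // defz negbK.
have [u' Du' defu] := zigzag_next Du defz.
have [v [v' defu2]] := zigzag Du' defu.
exists v'; apply/eqP; rewrite -subr_eq0; apply/eqP/exact_row0.
rewrite mulmxBl defz defu2 mulmxDl -!mulmxA.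
have := shiftX_mul (C 1) (~~ b); rewrite negbK => ->.
by rewrite mulmx0 add0r shiftX_hom ?subrr //; apply: cdiff_hom.
Qed.

(** Off the E-summands, dz has high weight because z is in the socle. As z X = 0, the zigzag gives z
    = v X^(p-1); but X is 0 on k[G/E], so the E-components of z vanish. *)
Lemma socle_component_generic (I0 I1 : finType) (F0 : I0 -> {group gT})
    (F1 : I1 -> {group gT}) (d0 : perm_decomp (C 0) F0)
    (d1 : perm_decomp (C 1) F1) (z : 'rV_(rdegree (C 0))) :
    (forall i, F0 i \in H) -> (forall i, F1 i \in H) ->
    (forall g, g \in G -> z *m C 0%N g = z) ->
    (forall i, F0 i != E -> z *m prj_mx d0 i = 0) ->
    (forall j, F1 j = E -> z *m cdiff C 0 *m prj_mx d1 j = 0) ->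
  z = 0.
Proof.
move=> HF0 HF1 fixz zE dzE.
have fixzi i g : g \in G -> z *m prj_mx d0 i *m R (F0 i) g = z *m prj_mx d0 i.
  by move=> Gg; rewrite -mulmxA -prj_mx_hom // mulmxA fixz.
have Ddz: in_top (z *m cdiff C 0).
  apply: (in_topP (d := d1)) => // j; have [/dzE-> | neqE] := eqVneq (F1 j) E.
    exact: sub0mx.
  rewrite (decomp_row d0 z) !mulmx_suml summx_sub // => i _.
  have [eqE | /zE->] := eqVneq (F0 i) E; last by rewrite !mul0mx sub0mx.
  rewrite -[_ *m cdiff C 0 *m _]mulmxA -[_ *m inj_mx d0 i *m _]mulmxA.
  have sFG := H_sub (HF0 i).
  have degE: (p.-1 * ((logn p #|G|).*2 - logn p #|E| - logn p #|F0 i|)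
      <= (p.-1 * logn p #|G : (G :&: F0 i)%SET|).*2)%N.
    rewrite (setIidPr sFG) -divgS // logn_div ?cardSg // eqE.
    by rewrite doubleMr leq_mul2l; apply/orP; right; lia.
  apply: (hom_into_top_filt char_k abelG H_sub H_index sEG (HF0 i) (HF1 j)).
  - by rewrite eqE eq_sym.
  - apply: kG_hom_comp; first exact: inj_mx_hom.
    by apply: kG_hom_comp; [apply: cdiff_hom | apply: prj_mx_hom].
  - exact: degE.
  - exact: (fixed_sub_aug_pow char_k abelG sFG (subxx G) (fixzi i)).
have [v defz] : exists v, z = v *m shiftX (C 0) true.
  apply: zigzag0 => //; rewrite /shiftX expr1.
  by apply: (shift_mx_fixed a) => e Ee; apply/fixz/(subsetP sEG).
have p1_gt0 : (0 < p.-1)%N by rewrite -subn1 subn_gt0 prime_gt1.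
rewrite (decomp_row d0 z) big1 // => i _.
have [eqE | /zE->] := eqVneq (F0 i) E; last by rewrite mul0mx.
rewrite defz -[v *m _ *m _]mulmxA shiftX_hom; last exact: prj_mx_hom.
rewrite /shiftX -(prednK p1_gt0) exprS -mulmxE [X _](_ : _ = 0) ?mul0mx ?mulmx0 ?mul0mx //.
rewrite -[LHS]mul1mx; apply: shift_mx_fixed => e Ee.
by rewrite (coset_repr_triv _ abelG) ?eqE // mul1mx.
Qed.

End ZigZag.

(** * Extension of scalars to a generic point *)

Section BaseChange.

Variables (k K : fieldType) (phi : {rmorphism k -> K}).
Variables (gT : finGroupType) (G : {group gT}).
Local Notation "M ^phi" := (map_mx phi M) (at level 2, format "M ^phi") : ring_scope.

Definition map_grepr (V : representation k G) : representation K G :=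
  Representation (map_repr phi V).

Lemma map_coset_repr (F : {group gT}) g :
  (coset_repr k G F g)^phi = coset_repr K G F g.
Proof. by apply/matrixP=> i j; rewrite !mxE rmorph_nat. Qed.

Lemma map_kG_hom (V W : representation k G) f :
  kG_hom (V := V) (W := W) f -> kG_hom (V := map_grepr V) (W := map_grepr W) f^phi.
Proof. by move=> homf g Gg; rewrite /= /map_repr_mx -!map_mxM homf. Qed.

Lemma map_perm_decomp (V : representation k G) (I : finType) (F : I -> {group gT})
    (d : perm_decomp V F) :
  {d' : perm_decomp (map_grepr V) F | forall i, prj_mx d' i = (prj_mx d i)^phi}.
Proof.
have homi i : kG_hom (V := coset_repr K G (F i)) (W := map_grepr V) (inj_mx d i)^phi.
  by move=> g Gg; rewrite -map_coset_repr /= /map_repr_mx -!map_mxM -inj_mx_hom.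
have homp i : kG_hom (V := map_grepr V) (W := coset_repr K G (F i)) (prj_mx d i)^phi.
  by move=> g Gg; rewrite -map_coset_repr /= /map_repr_mx -!map_mxM -prj_mx_hom.
unshelve eexists (@PermDecomp K gT G (map_grepr V) I F _ _ homi homp _ _ _) => //.
- by move=> i; rewrite -map_mxM inj_prj_id map_mx1.
- by move=> i j neq; rewrite -map_mxM inj_prj_neq // map_mx0.
- transitivity ((\sum_i prj_mx d i *m inj_mx d i)^phi); last first.
    by rewrite sum_prj_inj map_mx1.
  by rewrite raddf_sum; apply: eq_bigr => i _; rewrite /= map_mxM.
Qed.

Lemma map_perm_sum (H : {set {group gT}}) (V : representation k G) :
  perm_sum H V -> perm_sum H (map_grepr V).
Proof.
case=> I [F [HF [d]]]; exists I, F; split=> //.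
by constructor; case: (map_perm_decomp d).
Qed.

Definition map_complex (C : cochain_complex k G) : cochain_complex K G.
Proof.
exists (fun i => map_grepr (C i)) (fun i => (cdiff C i)^phi) => i.
  by apply: map_kG_hom; apply: cdiff_hom.
by rewrite /= -map_mxM cdiff_comp map_mx0.
Defined.

Lemma map_complex_exact (C : cochain_complex k G) :
  exact C -> exact (map_complex C).
Proof.
case=> ex0 exS; split=> [|i] /=.
  by rewrite -map_kermx -(map_mx0 phi) !map_submx.
by rewrite -map_kermx !map_submx.
Qed.

End BaseChange.

Section GenericPoint.

Variables (k : fieldType) (gT : finGroupType) (E : {set gT}).

Definition generic_embed : {rmorphism k -> {fraction {poly k}}} :=
  (@tofrac {poly k}) \o (@polyC k).

(** Distinct powers of one variable are linearly independent over k, so k(t) has enough room. *)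
Definition generic_coef (e : gT) : {fraction {poly k}} :=
  tofrac 'X^(enum_rank e).

Lemma generic_coefP (c : gT -> nat) :
    (exists2 e, e \in E & (c e)%:R != 0 :> {fraction {poly k}}) ->
  \sum_(e in E) generic_coef e * (c e)%:R != 0.
Proof.
case=> e0 Ee0 nz_c0.
have -> : \sum_(e in E) generic_coef e * (c e)%:R
          = tofrac (\sum_(e in E) 'X^(enum_rank e) * (c e)%:R%:P).
  by rewrite rmorph_sum; apply: eq_bigr => e _; rewrite rmorphM /= !rmorph_nat.
rewrite tofrac_eq0; apply/eqP=> /(congr1 (fun q : {poly k} => q`_(enum_rank e0))).
rewrite coef0 coef_sum (bigD1 e0) //= big1 => [|e /andP[_ neq_e]]; last first.
  rewrite coefMC coefXn eq_sym (inj_eq val_inj) (inj_eq enum_rank_inj).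
  by rewrite (negPf neq_e) mul0r.
rewrite coefMC coefXn eqxx mul1r addr0 => c0.
by case/eqP: nz_c0; rewrite -[RHS](rmorph0 generic_embed) -c0 rmorph_nat.
Qed.

End GenericPoint.

Section SocleComponent.

Variables (k : fieldType) (p : nat) (gT : finGroupType) (G : {group gT}).
Hypotheses (char_k : p \in [pchar k]) (abelG : p.-abelem G).
Variables (H : {set {group gT}}).
Hypothesis H_sub : forall E : {group gT}, E \in H -> E \subset G.
Hypothesis H_index : ~ exists E F : {group gT},
  [/\ E \in H, F \in H, E \subset F & #|F : E|%g = p].
Variables (l : nat) (C : cochain_complex k G).
Hypotheses (C_bounded : bounded_by l C) (C_exact : exact C).
Hypothesis C_perm : forall i, perm_sum H (C i).

(** All hypotheses survive the extension to k(t), and z is 0 if its image there is 0. *)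
Lemma socle_component (E : {group gT}) (I0 I1 : finType) (F0 : I0 -> {group gT})
    (F1 : I1 -> {group gT}) (d0 : perm_decomp (C 0) F0)
    (d1 : perm_decomp (C 1) F1) (z : 'rV_(rdegree (C 0))) :
    E \in H -> (forall i, F0 i \in H) -> (forall i, F1 i \in H) ->
    (forall g, g \in G -> z *m C 0%N g = z) ->
    (forall i, F0 i != E -> z *m prj_mx d0 i = 0) ->
    (forall j, F1 j = E -> z *m cdiff C 0 *m prj_mx d1 j = 0) ->
  z = 0.
Proof.
move=> HE HF0 HF1 fixz zE dzE; set phi := generic_embed k.
have [d0' d0'E] := map_perm_decomp phi d0.
have [d1' d1'E] := map_perm_decomp phi d1.
apply/eqP; rewrite -(map_mx_eq0 phi); apply/eqP.
have charK : p \in [pchar {fraction {poly k}}] by apply: (rmorph_pchar phi).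
apply: (@socle_component_generic _ p gT G charK abelG H H_sub H_index E
  (@generic_coef k gT) HE (@generic_coefP k gT E) l (map_complex phi C) _ _ _
  I0 I1 F0 F1 d0' d1' (map_mx phi z)) => //.
- exact: map_complex_exact.
- by move=> i; apply: map_perm_sum.
- by move=> g Gg; rewrite /= /map_repr_mx -map_mxM fixz.
- by move=> i /zE; rewrite d0'E -map_mxM => ->; rewrite map_mx0.
- by move=> j /dzE; rewrite d1'E /= -!map_mxM => ->; rewrite map_mx0.
Qed.

End SocleComponent.

(** * Splitting of the first differential *)

Section CosetSocle.

Variables (k : fieldType) (p : nat) (gT : finGroupType) (G : {group gT}).
Hypotheses (char_k : p \in [pchar k]) (abelG : p.-abelem G).
Local Notation R F := (coset_repr k G F).

(** The sum of all cosets, which spans the G-fixed vectors of k[G/F] ([coset_fixed]). *)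
Definition coset_socle (F : {group gT}) : 'rV[k]_#|rcosets F G| := const_mx 1.

Lemma coset_mxE (F : {group gT}) (v : 'rV_#|rcosets F G|) g i j : g \in G ->
  enum_val i :* g = enum_val j -> (v *m R F g) 0 j = v 0 i.
Proof.
move=> Gg defj; rewrite mxE (bigD1 i) //= mxE defj eqxx mulr1 big1 ?addr0 // => l neq_l.
rewrite mxE -defj; case: eqP => [eq_lg | _]; last by rewrite mulr0.
case/eqP: neq_l; apply: enum_val_inj.
by rewrite -[enum_val l](rcosetK g) eq_lg rcosetK.
Qed.

Lemma rcoset_transl (F : {group gT}) (i : 'I_#|rcosets F G|) g : g \in G ->
  exists j : 'I_#|rcosets F G|, enum_val j = enum_val i :* g.
Proof.
move=> Gg; have Cg: enum_val i :* g \in rcosets F G.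
  have /rcosetsP[x Gx ->] := enum_valP i; rewrite -rcosetM.
  by apply/rcosetsP; exists (x * g)%g; rewrite ?groupM.
by exists (enum_rank_in Cg (enum_val i :* g)); rewrite enum_rankK_in.
Qed.

Lemma coset_socle_fixed (F : {group gT}) g : g \in G ->
  coset_socle F *m R F g = coset_socle F.
Proof.
move=> Gg; apply/rowP=> j; have [i defi] := rcoset_transl j (groupVr Gg).
by rewrite (@coset_mxE F _ g i j) // ?mxE // defi -rcosetM mulVg rcoset1.
Qed.

Lemma coset_ord_gt0 (F : {group gT}) : (0 < #|rcosets F G|)%N.
Proof. by apply/card_gt0P; exists (F :* 1); apply/rcosetsP; exists 1%g. Qed.

Definition coset_coef (F : {group gT}) (v : 'rV[k]_#|rcosets F G|) : k :=
  v 0 (Ordinal (coset_ord_gt0 F)).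

Lemma coset_coef_socle F c : coset_coef (c *: coset_socle F) = c.
Proof. by rewrite /coset_coef !mxE mulr1. Qed.

Lemma coset_fixed (F : {group gT}) (v : 'rV_#|rcosets F G|) :
  (forall g, g \in G -> v *m R F g = v) -> v = coset_coef v *: coset_socle F.
Proof.
move=> fixv; apply/rowP=> j; rewrite !mxE mulr1 /coset_coef; set i := Ordinal _.
have /rcosetsP[x Gx defi] := enum_valP i.
have /rcosetsP[y Gy defj] := enum_valP j.
rewrite -[in LHS](fixv (x^-1 * y)%g) ?groupM ?groupV //; apply: coset_mxE.
  by rewrite groupM ?groupV.
by rewrite defi -rcosetM mulKVg.
Qed.

(** The socle of k[G/F1] has J-adic degree (p-1) lg(G/F1), and f raises it to (p-1) lg(G / F1 :&:
    F2). In k[G/F2] degrees above (p-1) lg(G/F2) vanish, which forces F2 into F1. *)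
Lemma hom_socle_card (F1 F2 : {group gT}) (f : 'M_(_, _)) :
    F1 \subset G -> F2 \subset G -> F1 != F2 ->
    kG_hom (V := R F1) (W := R F2) f -> coset_socle F1 *m f != 0 ->
  (#|F2| < #|F1|)%N.
Proof.
move=> sF1 sF2 neqF homf nz; suffices sF21: F2 \subset F1.
  by apply: proper_card; rewrite properEneq sF21 eq_sym andbT (inj_eq val_inj).
have pG := abelem_pgroup abelG.
have sS : (coset_socle F1 <= aug_pow (R F1) G (p.-1 * logn p #|G : (G :&: F1)%SET|))%MS.
  by apply: (fixed_sub_aug_pow char_k abelG) => // g; apply: coset_socle_fixed.
have sf := aug_pow_hom (r1 := R F1) (p.-1 * logn p #|G : (G :&: F1)%SET|) homf
  (coset_hom_sub_aug_pow char_k abelG sF1 sF2 homf).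
have leF1: (logn p #|F1| <= logn p #|G|)%N.
  by rewrite dvdn_leq_log ?cardG_gt0 ?cardSg // (pcharf_prime char_k).
have leF2: (logn p #|F2| <= logn p #|G|)%N.
  by rewrite dvdn_leq_log ?cardG_gt0 ?cardSg // (pcharf_prime char_k).
have leI: (logn p #|(F1 :&: F2)%G| <= logn p #|F1|)%N.
  by rewrite dvdn_leq_log ?cardG_gt0 ?cardSg ?subsetIl // (pcharf_prime char_k).
have leI2: (logn p #|(F1 :&: F2)%G| <= logn p #|F2|)%N.
  by rewrite dvdn_leq_log ?cardG_gt0 ?cardSg ?subsetIr // (pcharf_prime char_k).
have := submx_trans (submxMr f sS) sf; rewrite (setIidPr sF1) -mulnDr.
rewrite -!divgS ?subsetIl // !logn_div ?cardSg ?subsetIl //.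
have [lt | le _] := ltnP (p.-1 * logn p #|G : F2|)
  (p.-1 * (logn p #|G| - logn p #|F1| + (logn p #|F1| - logn p #|F1 :&: F2|))).
  by rewrite (aug_pow_coset_max char_k abelG) // submx0 (negPf nz).
have p1_gt0 : (0 < p.-1)%N by rewrite -subn1 subn_gt0 prime_gt1 ?(pcharf_prime char_k).
move: le; rewrite leq_pmul2l // -divgS // logn_div ?cardSg // => le.
have eq_log: logn p #|(F1 :&: F2)%G| = logn p #|F2|.
  by move: le leF1 leF2 leI leI2 => /=; lia.
have [_ eqI _] := log_card_sub pG (subsetIr F1 F2) sF2.
by rewrite -{1}(congr1 val (eqI eq_log)) subsetIl.
Qed.

End CosetSocle.

Section FixedVectors.

Variables (k : fieldType) (p : nat) (gT : finGroupType) (G : {group gT}).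
Hypotheses (char_k : p \in [pchar k]) (pG : p.-group G).

(** The kernel is a submodule; if it were nonzero, the p-group G would fix a nonzero vector in
    it. *)
Lemma pgroup_hom_unit (V : representation k G) (f : 'M_(rdegree V)) :
    kG_hom (V := V) (W := V) f ->
    (forall v : 'rV_(rdegree V), (forall g, g \in G -> v *m V g = v) ->
       v *m f = 0 -> v = 0) ->
  f \in unitmx.
Proof.
move=> homf fix_inj; rewrite -row_free_unit -kermx_eq0.
have cf : centgmx V f by apply/centgmxP=> g Gg; rewrite homf.
have modK := kermx_centg_module cf.
rewrite -mxrank_eq0 -leqn0 leqNgt; apply/negP=> rk_gt0.
have := rfix_pgroup_pchar char_k (submod_repr modK) rk_gt0 pG (subxx G).
rewrite -submx0 (rfix_submod modK (subxx G)) submx0.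
suffices ->: (kermx f :&: rfix_mx V G)%MS = 0 by rewrite in_submodE mul0mx eqxx.
apply/eqP/rowV0P => v; rewrite sub_capmx => /andP[/sub_kermxP vf0 /rfix_mxP fixv].
exact: fix_inj.
Qed.

End FixedVectors.

Section FirstDifferential.

Variables (k : fieldType) (p : nat) (gT : finGroupType) (G : {group gT}).
Hypotheses (char_k : p \in [pchar k]) (abelG : p.-abelem G).
Variables (H : {set {group gT}}).
Hypothesis H_sub : forall E : {group gT}, E \in H -> E \subset G.
Hypothesis H_index : ~ exists E F : {group gT},
  [/\ E \in H, F \in H, E \subset F & #|F : E|%g = p].
Variables (l : nat) (C : cochain_complex k G).
Hypotheses (C_bounded : bounded_by l C) (C_exact : exact C).
Hypothesis C_perm : forall i, perm_sum H (C i).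
Local Notation R F := (coset_repr k G F).

Section Decomposed.

Variables (I0 I1 : finType) (F0 : I0 -> {group gT}) (F1 : I1 -> {group gT}).
Variables (d0 : perm_decomp (C 0) F0) (d1 : perm_decomp (C 1) F1).
Hypotheses (HF0 : forall i, F0 i \in H) (HF1 : forall j, F1 j \in H).

Let comp i j := inj_mx d0 i *m cdiff C 0 *m prj_mx d1 j.

Let comp_hom i j : kG_hom (V := R (F0 i)) (W := R (F1 j)) (comp i j).
Proof.
apply: kG_hom_comp (prj_mx_hom d1 j).
by apply: kG_hom_comp; [apply: inj_mx_hom | apply: cdiff_hom].
Qed.

Definition socle_mx : 'M[k]_(#|I0|, #|I1|) :=
  \matrix_(i, j)
    coset_coef (coset_socle k G (F0 (enum_val i)) *m comp (enum_val i) (enum_val j)).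

(** The block diagonal part of d on socles, with one block for each subgroup. *)
Definition socle_diag_mx : 'M[k]_(#|I0|, #|I1|) :=
  \matrix_(i, j) (socle_mx i j *+ (F0 (enum_val i) == F1 (enum_val j))).

Let socle_comp i j : coset_socle k G (F0 (enum_val i)) *m comp (enum_val i) (enum_val j)
  = socle_mx i j *: coset_socle k G (F1 (enum_val j)).
Proof.
rewrite mxE; apply: coset_fixed => g Gg.
by rewrite -mulmxA -(@comp_hom _ _ g Gg) mulmxA coset_socle_fixed.
Qed.

Definition socle_row (i : 'I_#|I0|) : 'rV_(rdegree (C 0)) :=
  coset_socle k G (F0 (enum_val i)) *m inj_mx d0 (enum_val i).

Let socle_row_fixed i g : g \in G -> socle_row i *m C 0%N g = socle_row i.
Proof. by move=> Gg; rewrite -mulmxA -inj_mx_hom // mulmxA coset_socle_fixed. Qed.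

Let socle_row_prj (u : 'rV_#|I0|) (i : I0) :
  (\sum_b u 0 b *: socle_row b) *m prj_mx d0 i
    = u 0 (enum_rank i) *: coset_socle k G (F0 i).
Proof.
rewrite mulmx_suml (bigD1 (enum_rank i)) //= big1 => [|b neq_bi].
  rewrite addr0 -scalemxAl /socle_row enum_rankK -mulmxA.
  by rewrite inj_prj_id mulmx1.
rewrite -scalemxAl /socle_row -mulmxA inj_prj_neq ?mulmx0 ?scaler0 //.
by apply: contraNneq neq_bi => <-; rewrite enum_valK.
Qed.

Let socle_row_diff (u : 'rV_#|I0|) (j : I1) :
  (\sum_b u 0 b *: socle_row b) *m cdiff C 0 *m prj_mx d1 j
    = (u *m socle_mx) 0 (enum_rank j) *: coset_socle k G (F1 j).
Proof.
rewrite !mulmx_suml mxE scaler_suml; apply: eq_bigr => b _.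
rewrite -!scalemxAl /socle_row -scalerA; congr (_ *: _).
have := socle_comp b (enum_rank j); rewrite enum_rankK => <-.
by rewrite !mulmxA.
Qed.

Let socle_row_inj (u : 'rV_#|I0|) : \sum_b u 0 b *: socle_row b = 0 -> u = 0.
Proof.
move=> u0; apply/rowP=> b; rewrite mxE.
have := socle_row_prj u (enum_val b); rewrite u0 mul0mx enum_valK => /esym e0.
by have := congr1 (@coset_coef _ _ _ _) e0; rewrite coset_coef_socle /coset_coef mxE.
Qed.

(** One block at a time: for each E, [socle_component] is applied to the part of the vector
    supported on the summands k[G/E]. *)
Lemma socle_diag_free : row_free socle_diag_mx.
Proof.
apply: inj_row_free => u uM0; apply/rowP=> a; rewrite mxE.
pose E := F0 (enum_val a).
pose v : 'rV_#|I0| := \row_b (u 0 b *+ (F0 (enum_val b) == E)).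
suffices v0: v = 0 by have := congr1 (fun w : 'rV_#|I0| => w 0 a) v0; rewrite !mxE eqxx.
apply: socle_row_inj.
apply: (socle_component char_k abelG H_sub H_index C_bounded C_exact C_perm
  (E := E) (d0 := d0) (d1 := d1)) => //.
- by rewrite /E HF0.
- move=> g Gg; rewrite mulmx_suml; apply: eq_bigr => b _.
  by rewrite -scalemxAl socle_row_fixed.
- by move=> i neqE; rewrite socle_row_prj mxE enum_rankK (negPf neqE) mulr0n scale0r.
move=> j eqE; rewrite socle_row_diff.
suffices ->: (v *m socle_mx) 0 (enum_rank j) = 0 by rewrite scale0r.
have <-: (u *m socle_diag_mx) 0 (enum_rank j) = 0 by rewrite uM0 mxE.
rewrite !mxE; apply: eq_bigr => b _.
by rewrite [v _ _]mxE [socle_diag_mx _ _]mxE enum_rankK eqE mulrnAl mulrnAr.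
Qed.

(** Typed for any two subgroups, so that the identity between summands with F = F' needs no cast. *)
Definition coset_id_mx (F F' : {group gT}) : 'M[k]_(#|rcosets F G|, #|rcosets F' G|) :=
  \matrix_(i, j) (enum_val i == enum_val j)%:R.

Lemma coset_id_mx1 F : coset_id_mx F F = 1%:M.
Proof. by apply/matrixP=> i j; rewrite !mxE (inj_eq enum_val_inj). Qed.

Lemma coset_id_socle F F' :
  F = F' -> coset_socle k G F *m coset_id_mx F F' = coset_socle k G F'.
Proof. by move=> ->; rewrite coset_id_mx1 mulmx1. Qed.

(** The pseudo-inverse need not be block diagonal; cutting it down to its diagonal blocks keeps it a
    right inverse ([diag_back]) and makes it liftable to a kG-map. *)
Definition back_coef : 'M[k]_(#|I1|, #|I0|) :=
  \matrix_(j, i) (pinvmx socle_diag_mx j i *+ (F1 (enum_val j) == F0 (enum_val i))).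

Definition back_mx : 'M_(rdegree (C 1), rdegree (C 0)) :=
  \sum_j \sum_i back_coef j i *: (prj_mx d1 (enum_val j) *m
     coset_id_mx (F1 (enum_val j)) (F0 (enum_val i)) *m inj_mx d0 (enum_val i)).

Lemma back_mx_hom : kG_hom (V := C 1) (W := C 0) back_mx.
Proof.
apply: kG_hom_sum => j; apply: kG_hom_sum => i; rewrite mxE.
case: eqVneq => [eqF | _]; last by rewrite mulr0n scale0r; apply: kG_hom0.
apply: kG_homZ; apply: kG_hom_comp (inj_mx_hom d0 _).
apply: kG_hom_comp (prj_mx_hom d1 _) _.
by rewrite eqF coset_id_mx1; apply: kG_hom1.
Qed.

Let socle_row_back (u : 'rV_#|I0|) :
  (\sum_b u 0 b *: socle_row b) *m (cdiff C 0 *m back_mx)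
    = \sum_b (u *m (socle_mx *m back_coef)) 0 b *: socle_row b.
Proof.
rewrite [LHS]mulmxA /back_mx mulmx_sumr.
transitivity (\sum_j \sum_b ((u *m socle_mx) 0 j * back_coef j b) *: socle_row b).
  apply: eq_bigr => j _; rewrite mulmx_sumr; apply: eq_bigr => b _.
  rewrite -scalemxAr !mulmxA socle_row_diff enum_valK -!scalemxAl scalerA mulrC.
  rewrite [back_coef _ _]mxE; case: eqVneq => [eqF | _]; last by rewrite mulr0n mulr0 !scale0r.
  by rewrite coset_id_socle.
rewrite exchange_big /=; apply: eq_bigr => b _.
by rewrite mulmxA [in RHS]mxE scaler_suml.
Qed.

Let diag_back : socle_diag_mx *m back_coef = 1%:M.
Proof.
rewrite -(mulmxVp socle_diag_free); apply/matrixP=> i i'; rewrite !mxE.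
have [eqF | neqF] := eqVneq (F0 (enum_val i)) (F0 (enum_val i')).
  apply: eq_bigr => j _; rewrite [back_coef _ _]mxE [socle_diag_mx _ _]mxE -eqF eq_sym.
  by case: (_ == _); rewrite ?mulr1n ?mulr0n ?mul0r.
transitivity (0 : k).
  apply: big1 => j _; rewrite [back_coef _ _]mxE [socle_diag_mx _ _]mxE.
  case: eqVneq => [eqF1 | _]; last by rewrite mul0r.
  by rewrite -eqF1 (negPf neqF) mulr0.
have := congr1 (fun M : 'M_#|I0| => M i i') (mulmxVp socle_diag_free).
rewrite !mxE => ->; rewrite (negPf (contraNneq _ neqF)) // => ->.
by rewrite eqxx.
Qed.

Let back_diag i i' : F0 (enum_val i) = F0 (enum_val i') ->
  (socle_mx *m back_coef) i i' = (i == i')%:R.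
Proof.
move=> eqF; transitivity ((socle_diag_mx *m back_coef) i i').
  rewrite !mxE; apply: eq_bigr => j _.
  rewrite [back_coef _ _]mxE [socle_diag_mx _ _]mxE -eqF eq_sym.
  by case: (_ == _); rewrite ?mulr1n ?mulr0n ?mulr0 ?mul0r.
by rewrite diag_back mxE.
Qed.

Let back_triangular i i' : F0 (enum_val i) != F0 (enum_val i') ->
  (socle_mx *m back_coef) i i' != 0 ->
  (#|F0 (enum_val i')| < #|F0 (enum_val i)|)%N.
Proof.
move=> neqF; rewrite mxE => /eqP nz.
have [j nzj | z] := pickP (fun j => socle_mx i j * back_coef j i' != 0); last first.
  by case: nz; apply: big1 => j _; apply/eqP/negbFE/z.
have eqF : F1 (enum_val j) = F0 (enum_val i').
  by apply/eqP/(contraNT _ nzj) => /negPf neq; rewrite [back_coef _ _]mxE neq mulr0.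
rewrite -eqF in neqF *.
apply: (hom_socle_card char_k abelG _ _ neqF (comp_hom (enum_val i) (enum_val j))).
- exact: H_sub.
- exact: H_sub.
apply: contraNneq nzj => c0; rewrite mxE c0 /coset_coef mxE mul0r.
exact: eqxx.
Qed.

(** On fixed vectors this map is unitriangular for the ordering of the summands by the order of F,
    hence injective there. *)
Lemma diff_back_unit : cdiff C 0 *m back_mx \in unitmx.
Proof.
apply: (pgroup_hom_unit char_k (abelem_pgroup abelG)).
  by apply: kG_hom_comp back_mx_hom; apply: cdiff_hom.
move=> v fixv vA0.
pose u : 'rV_#|I0| := \row_b coset_coef (v *m prj_mx d0 (enum_val b)).
have defv : v = \sum_b u 0 b *: socle_row b.
  rewrite {1}(decomp_row d0 v) (reindex_onto enum_val enum_rank) =>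
    [|i _] /=; last exact: enum_rankK.
  apply: eq_big => [b | b _]; first by rewrite enum_valK eqxx.
  rewrite mxE /socle_row scalemxAl -coset_fixed // => g Gg.
  by rewrite -mulmxA -prj_mx_hom // mulmxA fixv.
move: vA0; rewrite defv socle_row_back => /socle_row_inj uM0.
suffices ->: u = 0 by apply: big1 => b _; rewrite mxE scale0r.
apply/eqP; apply: contraTT isT => /rV0Pn[a0 nz_a0].
pose P b := u 0 b != 0.
(* Off-diagonal contributions to coordinate a come only from larger subgroups, where u is 0 by the
   choice of a. *)
case: (@arg_maxnP _ a0 P (fun b => #|F0 (enum_val b)|) nz_a0) => a nz_a max_a.
have := congr1 (fun w : 'rV_#|I0| => w 0 a) uM0; rewrite mxE [RHS]mxE.
rewrite (bigD1 a) //= back_diag // eqxx mulr1 big1 ?addr0 => [/eqP|b neq_ba].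
  by rewrite (negPf nz_a).
have [-> | nz_b] := eqVneq (u 0 b) 0; first by rewrite mul0r.
have [eqF | neqF] := eqVneq (F0 (enum_val b)) (F0 (enum_val a)).
  by rewrite back_diag // (negPf neq_ba) mulr0.
have [-> | nz_ba] := eqVneq ((socle_mx *m back_coef) b a) 0; first by rewrite mulr0.
by have /= := max_a b nz_b; rewrite leqNgt back_triangular.
Qed.

End Decomposed.

Lemma first_diff_split : exists2 r : 'M_(rdegree (C 1), rdegree (C 0)),
  kG_hom (V := C 1) (W := C 0) r & cdiff C 0 *m r = 1%:M.
Proof.
have [I0 [F0 [HF0 [d0]]]] := C_perm 0; have [I1 [F1 [HF1 [d1]]]] := C_perm 1.
have unitA := diff_back_unit d0 d1 HF0 HF1.
set g := back_mx d0 d1 in unitA; exists (g *m invmx (cdiff C 0 *m g)).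
  apply: kG_hom_comp; first exact: back_mx_hom.
  move=> x Gx; apply: (can_inj (mulKmx unitA)); rewrite mulKVmx //.
  rewrite mulmxA -(kG_hom_comp (@cdiff_hom _ _ _ C 0) (back_mx_hom d0 d1)) //.
  by rewrite mulmxK.
by rewrite mulmxA mulmxV.
Qed.

End FirstDifferential.

(** * Induction on the length *)

Section PermSums.

Variables (k : fieldType) (gT : finGroupType) (G : {group gT}) (H : {set {group gT}}).
Implicit Types V W : representation k G.
Local Notation R F := (coset_repr k G F).

Lemma perm_sum0 V : rdegree V = 0%N -> perm_sum H V.
Proof.
move=> V0; have hom i : kG_hom (V := R ((fun=> 1%G) (i : void))) (W := V) 0 by case: i.
have hom' i : kG_hom (V := V) (W := R ((fun=> 1%G) (i : void))) 0 by case: i.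
exists void, (fun=> 1%G); split; first by case.
constructor; unshelve eapply (PermDecomp hom hom').
- by case.
- by case.
rewrite big1 => [|[]//]; apply/matrixP=> i.
by have := ltn_ord i; rewrite {2}V0.
Qed.

Lemma perm_sum_coset (E : {group gT}) : E \in H -> perm_sum H (R E).
Proof.
move=> HE; exists unit, (fun=> E); split=> //; constructor.
have hom (i : unit) : kG_hom (V := R E) (W := R E) 1%:M by apply: kG_hom1.
unshelve eapply (@PermDecomp _ _ _ (R E) unit (fun=> E) _ _ hom hom).
- by move=> _; rewrite mulmx1.
- by do 2!case.
by rewrite (big_pred1 tt) ?mulmx1 // => -[].
Qed.

Lemma perm_sum_dadd V W : perm_sum H V -> perm_sum H W -> perm_sum H (dadd_grepr V W).
Proof.
case=> I [F [HF [d]]] [J [F' [HF' [d']]]].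
pose FF (i : I + J) := match i with inl i => F i | inr j => F' j end.
pose io (i : I + J) : 'M[k]_(rdegree (R (FF i)), rdegree V + rdegree W) :=
  match i with inl i => row_mx (inj_mx d i) 0 | inr j => row_mx 0 (inj_mx d' j) end.
pose pr (i : I + J) : 'M[k]_(rdegree V + rdegree W, rdegree (R (FF i))) :=
  match i with inl i => col_mx (prj_mx d i) 0 | inr j => col_mx 0 (prj_mx d' j) end.
exists (I + J)%type, FF; split; first by case.
constructor.
have homio i : kG_hom (V := R (FF i)) (W := dadd_grepr V W) (io i).
  move=> g Gg; case: i => i /=.
    by rewrite mul_row_block mul_mx_row ?mulmx0 ?mul0mx !addr0 inj_mx_hom.
  by rewrite mul_row_block mul_mx_row ?mulmx0 ?mul0mx !add0r inj_mx_hom.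
have hompr i : kG_hom (V := dadd_grepr V W) (W := R (FF i)) (pr i).
  move=> g Gg; case: i => i /=.
    by rewrite mul_block_col mul_col_mx ?mulmx0 ?mul0mx !addr0 prj_mx_hom.
  by rewrite mul_block_col mul_col_mx ?mulmx0 ?mul0mx !add0r prj_mx_hom.
unshelve eapply (PermDecomp homio hompr).
- by case=> i /=; rewrite mul_row_col ?mulmx0 ?mul0mx ?addr0 ?add0r inj_prj_id.
- case=> i [] j neq /=; rewrite mul_row_col ?mulmx0 ?mul0mx ?addr0 ?add0r //.
    exact: inj_prj_neq.
  exact: inj_prj_neq.
rewrite big_sumType /=.
transitivity (block_mx (1%:M : 'M[k]_(rdegree V)) 0 0 (1%:M : 'M[k]_(rdegree W))); last first.
  by rewrite -scalar_mx_block.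
rewrite -(sum_prj_inj d) -(sum_prj_inj d').
rewrite (eq_bigr (fun i => block_mx (prj_mx d i *m inj_mx d i) 0 0 0)); last first.
  by move=> i _; rewrite mul_col_row ?mulmx0 ?mul0mx.
rewrite [X in _ + X](eq_bigr (fun i => block_mx 0 0 0 (prj_mx d' i *m inj_mx d' i))); last first.
  by move=> i _; rewrite mul_col_row ?mulmx0 ?mul0mx.
have sumul (A : I -> 'M[k]_(rdegree V)) :
    \sum_i block_mx (A i) 0 0 (0 : 'M[k]_(rdegree W)) = block_mx (\sum_i A i) 0 0 0.
  by elim/big_rec2: _ => [|i y1 y2 _ ->]; rewrite ?block_mx0 // add_block_mx !addr0.
have sumdr (A : J -> 'M[k]_(rdegree W)) :
    \sum_i block_mx (0 : 'M[k]_(rdegree V)) 0 0 (A i) = block_mx 0 0 0 (\sum_i A i).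
  by elim/big_rec2: _ => [|i y1 y2 _ ->]; rewrite ?block_mx0 // add_block_mx !addr0.
by rewrite sumul sumdr add_block_mx !addr0 !add0r.
Qed.

Lemma perm_sum_rsim V W : mx_rsim V W -> perm_sum H W -> perm_sum H V.
Proof.
case=> f eq_dim f_free homf [I [F [HF [d]]]].
have ff' : f *m pinvmx f = 1%:M by apply: mulmxVp.
have f'f : pinvmx f *m f = 1%:M.
  have f_full : row_full f by move/eqP: f_free => rk_f; rewrite /row_full rk_f; apply/eqP.
  by apply: (row_full_inj f_full); rewrite mulmxA ff' mul1mx mulmx1.
have homf' g : g \in G -> W g *m pinvmx f = pinvmx f *m V g.
  by move=> Gg; rewrite -[RHS]mulmx1 -ff' mulmxA -[_ *m V g *m f]mulmxA homf // !mulmxA f'f mul1mx.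
exists I, F; split=> //; constructor.
have homi i : kG_hom (V := R (F i)) (W := V) (inj_mx d i *m pinvmx f).
  by apply: kG_hom_comp (inj_mx_hom d i) homf'.
have homp i : kG_hom (V := V) (W := R (F i)) (f *m prj_mx d i).
  by apply: kG_hom_comp homf (prj_mx_hom d i).
unshelve eapply (PermDecomp homi homp).
- by move=> i; rewrite mulmxA -[_ *m f]mulmxA f'f mulmx1 inj_prj_id.
- by move=> i j neq; rewrite mulmxA -[_ *m f]mulmxA f'f mulmx1 inj_prj_neq.
transitivity (f *m (\sum_i prj_mx d i *m inj_mx d i) *m pinvmx f); last first.
  by rewrite sum_prj_inj mulmx1 ff'.
rewrite mulmx_sumr mulmx_suml.
by apply: eq_bigr => i _; rewrite !mulmxA.
Qed.

Lemma in_Add_perm_sum V :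
    in_Add (fun V => exists2 E : {group gT}, E \in H & V = R E) V ->
  perm_sum H V.
Proof.
case=> n [W [HW simV]]; apply: perm_sum_rsim simV _.
elim/big_ind: _ => [||i _]; [exact: perm_sum0 | exact: perm_sum_dadd |].
by have [E HE ->] := HW i; apply: perm_sum_coset.
Qed.

End PermSums.

Section Fold.

Variables (k : fieldType) (gT : finGroupType) (G : {group gT}).
Variables (C : cochain_complex k G) (r : 'M[k]_(rdegree (C 1), rdegree (C 0))).
Hypotheses (hom_r : kG_hom (V := C 1) (W := C 0) r).
Hypothesis d0r : cdiff C 0 *m r = 1%:M.

Definition fold_term i : representation k G :=
  match i with 0 => C 1 | 1 => dadd_grepr (C 2) (C 0) | i.+2 => C i.+3 end.

Definition fold_diff i : 'M[k]_(rdegree (fold_term i), rdegree (fold_term i.+1)) :=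
  match i with
  | 0 => row_mx (cdiff C 1) r
  | 1 => col_mx (cdiff C 2) 0
  | i.+2 => cdiff C i.+3
  end.

Lemma fold_diff_hom i : kG_hom (fold_diff i).
Proof.
case: i => [|[|i]] g Gg /=; last exact: cdiff_hom.
  by rewrite mul_row_block mul_mx_row !mulmx0 addr0 add0r (cdiff_hom C) // hom_r.
by rewrite mul_block_col mul_col_mx !mulmx0 ?mul0mx !addr0 (cdiff_hom C).
Qed.

Lemma fold_diff_comp i : fold_diff i *m fold_diff i.+1 = 0.
Proof.
case: i => [|[|i]] /=; last exact: cdiff_comp.
  by rewrite mul_row_col cdiff_comp mulmx0 addr0.
by rewrite mul_col_mx cdiff_comp mul0mx col_mx0.
Qed.

(* Since [r] splits the first differential, C is the direct sum of
   [C 0 = C 0] and a complex C' starting in degree 1; this is C' plus [C 0 = C 0]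
   placed so that every term is again a sum of terms of C. *)
Definition fold_complex : cochain_complex k G :=
  CochainComplex fold_diff_hom fold_diff_comp.

Lemma fold_exact : exact C -> exact fold_complex.
Proof.
case=> ex0 exS; have ker i : (kermx (cdiff C i.+1) <= cdiff C i)%MS by case/andP: (exS i).
split=> [|i]; apply/andP; split; rewrite ?sub0mx //=; last first.
- exact/sub_kermxP/fold_diff_comp.
- apply/rV_subP=> v /sub_kermxP; case: i v => [|[|i]] v /= v0.
  + rewrite -[v]hsubmxK in v0 *; rewrite mul_row_col mulmx0 addr0 in v0.
    have /submxP[u defu] : (lsubmx v <= cdiff C 1)%MS.
      by apply: submx_trans (ker 1%N); apply/sub_kermxP.
    (* Adding coboundaries does not change the image under d^1; these ones turn the r-component into
       [rsubmx v]. *)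
    apply/submxP; exists (u - u *m r *m cdiff C 0 + rsubmx v *m cdiff C 0).
    rewrite mul_mx_row !mulmxDl !mulNmx -!mulmxA cdiff_comp d0r !mulmx0 !mulmx1.
    by rewrite subr0 addr0 addrN add0r -defu.
  + have /submxP[u ->] : (v <= cdiff C 2)%MS by apply: submx_trans (ker 2); apply/sub_kermxP.
    apply/submxP; exists (row_mx u 0).
    by rewrite mul_row_col mul0mx addr0.
  + by apply: submx_trans (ker i.+3); apply/sub_kermxP.
apply/rV_subP=> v /sub_kermxP /=; rewrite mul_mx_row => /eqP.
rewrite row_mx_eq0 => /andP[/eqP v1 /eqP vr].
have /submxP[u defv] : (v <= cdiff C 0)%MS.
  by apply: submx_trans (ker 0%N); apply/sub_kermxP.
by rewrite submx0 defv -[u]mulmx1 -d0r mulmxA -defv vr mul0mx.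
Qed.

(** The copy of C^0 sits in degree 1, so the length drops only as far as 1. *)
Lemma fold_bounded l : bounded_by l.+2 C -> bounded_by l.+1 fold_complex.
Proof. by move=> bC [|[|i]] //= lti; apply: bC. Qed.

Lemma fold_perm_sum (H : {set {group gT}}) :
  (forall i, perm_sum H (C i)) -> forall i, perm_sum H (fold_complex i).
Proof. by move=> pC [|[|i]] //=; apply: perm_sum_dadd. Qed.

(** The contraction of C is [r] in degree 0, followed by the components of [s] between the terms of
    C. *)
Lemma fold_contractible : contractible fold_complex -> contractible C.
Proof.
case=> s [hom_s s0 sS].
pose a : 'M_(rdegree (C 2), rdegree (C 1)) :=
  usubmx (s 0%N : 'M_(rdegree (C 2) + rdegree (C 0), _)).
pose b : 'M_(rdegree (C 0), rdegree (C 1)) :=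
  dsubmx (s 0%N : 'M_(rdegree (C 2) + rdegree (C 0), _)).
have def_s0 : s 0%N = col_mx a b by rewrite vsubmxK.
pose c : 'M_(rdegree (C 3), rdegree (C 2)) :=
  lsubmx (s 1%N : 'M_(_, rdegree (C 2) + rdegree (C 0))).
pose e : 'M_(rdegree (C 3), rdegree (C 0)) :=
  rsubmx (s 1%N : 'M_(_, rdegree (C 2) + rdegree (C 0))).
have def_s1 : s 1%N = row_mx c e by rewrite hsubmxK.
pose h i : 'M[k]_(rdegree (C i.+1), rdegree (C i)) :=
  match i with 0 => r | 1 => a | 2 => c | i.+3 => s i.+2 end.
have hom_a : kG_hom (V := C 2) (W := C 1) a.
  move=> g Gg; have := hom_s 0%N g Gg; rewrite def_s0 /=.
  by rewrite mul_block_col mul_col_mx !mul0mx addr0 => /eq_col_mx[].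
have hom_c : kG_hom (V := C 3) (W := C 2) c.
  move=> g Gg; have := hom_s 1%N g Gg; rewrite def_s1 /=.
  by rewrite mul_row_block mul_mx_row !mulmx0 addr0 => /eq_row_mx[].
have eq1 : 1%:M = cdiff C 1 *m a + r *m cdiff C 0.
  have := s0; rewrite subr0 def_s0 /= mul_row_col => eq1; rewrite {1}eq1; congr (_ + r *m _).
  (* Left multiplication by d^0 identifies the remaining component [b] with d^0. *)
  have := congr1 (mulmx (cdiff C 0)) eq1.
  by rewrite mulmx1 mulmxDr !mulmxA cdiff_comp mul0mx add0r d0r mul1mx.
have eq2 : 1%:M = cdiff C 2 *m c + a *m cdiff C 1.
  have := sS 0%N; rewrite subr0 def_s0 def_s1 /= mul_col_row mul_col_row !mul0mx.
  by rewrite add_block_mx scalar_mx_block => /eq_block_mx[].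
have eq3 : 1%:M = cdiff C 3 *m s 2 + c *m cdiff C 2.
  by have := sS 1%N; rewrite subr0 def_s1 /= mul_row_col mulmx0 addr0.
exists h; split=> [[|[|[|i]]]||[|[|[|i]]]] /=; rewrite ?subr0 //.
- exact: hom_s i.+2.
- by have := sS i.+2; rewrite subr0.
Qed.

End Fold.

Section Contraction.

Variables (k : fieldType) (p : nat) (gT : finGroupType) (G : {group gT}).
Hypotheses (char_k : p \in [pchar k]) (abelG : p.-abelem G).
Variables (H : {set {group gT}}).
Hypothesis H_sub : forall E : {group gT}, E \in H -> E \subset G.
Hypothesis H_index : ~ exists E F : {group gT},
  [/\ E \in H, F \in H, E \subset F & #|F : E|%g = p].

Lemma mx_rank0_eq m n (A B : 'M[k]_(m, n)) : m = 0%N -> A = B.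
Proof. by move=> m0; apply/matrixP=> i; have := ltn_ord i; rewrite {2}m0. Qed.

Lemma perm_complex_contractible l (C : cochain_complex k G) :
    bounded_by l.+1 C -> exact C -> (forall i, perm_sum H (C i)) ->
  contractible C.
Proof.
elim: l C => [|l IHl] C bC exC pC.
all: have [r hom_r d0r] := first_diff_split char_k abelG H_sub H_index bC exC pC.
  (* With C^2 = 0, exactness makes d^0 surjective, so its one-sided inverse [r] is two-sided. *)
  have rd0 : r *m cdiff C 0 = 1%:M.
    have /submxP[M def1] : (1%:M <= cdiff C 0)%MS.
      apply: submx_trans (_ : _ <= kermx (cdiff C 1))%MS _.
        apply/sub_kermxP; apply: trmx_inj; apply: mx_rank0_eq; exact: bC.
      by case: exC => _ /(_ 0%N)/andP[].
    by rewrite def1 -{1}[r]mul1mx def1 -!mulmxA (mulmxA _ r) d0r mul1mx.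
  pose h i : 'M[k]_(rdegree (C i.+1), rdegree (C i)) :=
    match i with 0 => r | i.+1 => 0 end.
  exists h; split=> [[|i]||[|i]] //=; rewrite ?subr0 ?mulmx0 ?add0r //.
  - exact: kG_hom0.
  - by apply: mx_rank0_eq; apply: bC.
apply: (fold_contractible (hom_r := hom_r) d0r); apply: IHl.
- exact: fold_bounded.
- exact: fold_exact.
- exact: fold_perm_sum.
Qed.

End Contraction.

Theorem theorem3p1 (p : nat) (p_prime : prime p)
    (gT : finGroupType) (G : {group gT}) (abelG : (p.-abelem G)%g)
    (k : fieldType) (char_k : p \in [pchar k]%R)
    (H : {set {group gT}})
    (H_sub : forall E : {group gT}, E \in H -> E \subset G)
    (H_index : ~ exists E F : {group gT},
        [/\ E \in H, F \in H, E \subset F & #|F : E|%g = p])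
    (l : nat) (C : cochain_complex k G)
    (C_bounded : bounded_by l C)
    (C_exact : exact C)
    (C_Add : forall i : nat, (i <= l)%N ->
        in_Add (fun V : representation k G =>
                  exists2 E : {group gT}, E \in H & V = coset_repr k G E)
               (C i)) :
  contractible C.
Proof.
(* The bound is weakened from l to l + 1, since the induction starts with two-term complexes. *)
apply: (perm_complex_contractible char_k abelG H_sub H_index (l := l)) => // i.
  by move=> lt_li; apply: C_bounded; apply: ltnW.
have [/C_Add/in_Add_perm_sum // | lt_li] := leqP i l.
by apply: perm_sum0; apply: C_bounded.
Qed.
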